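(* Let $\omega\in\mathbb{R}$, $\gamma_1>0$, $\gamma_2>0$ and $q\in H^2(0,1)\cap H^1_0(0,1)$. Let $T\ge 2$ and let $(\tilde W^1,\tilde W^2,\tilde Z_1,\tilde Z_2,\tilde Z_3)$ be the solution of the following periodic forward/backward error system, where $k$ ranges over $\mathbb{N}=\{0,1,2,\dots\}$: $$\left\{\begin{array}{l} \tilde W^1_t=\tilde W^2,\quad \tilde W^2_t=\tilde W^1_{xx},\quad (t,x)\in(2kT,(2k+1)T)\times(0,1),\\ \tilde W^1_t=-\tilde W^2,\quad \tilde W^2_t=-\tilde W^1_{xx},\quad (t,x)\in((2k+1)T,(2k+2)T)\times(0,1),\\ \tilde W^1(t,0)=\gamma_1\tilde Z_1(t)+\gamma_1\gamma_2\tilde Z_3(t),\quad \tilde W^1(t,1)=0,\quad t\in(0,+\infty),\\ \tilde W^1(0,x)=-q(x),\quad \tilde W^2(0,x)=0,\quad x\in(0,1), \end{array}\right.$$ $$\left\{\begin{array}{l} \dot{\tilde Z}_1=\tilde Z_2-\gamma_2\tilde Z_1,\quad \dot{\tilde Z}_2=-\omega^2\tilde Z_1+\tilde W^1_x(t,0),\quad t\in(2kT,(2k+1)T),\\ \dot{\tilde Z}_1=-\tilde Z_2-\gamma_2\tilde Z_1,\quad \dot{\tilde Z}_2=\omega^2\tilde Z_1-\tilde W^1_x(t,0),\quad t\in((2k+1)T,(2k+2)T),\\ \dot{\tilde Z}_3=\tilde Z_1,\quad t\in(0,+\infty),\\ \tilde Z_1(0)=-y(0),\quad \tilde Z_2(0)=-\dot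 y(0),\quad \tilde Z_3(0)=0. \end{array}\right.$$ Then $$\lim_{n\to+\infty}\big(\tilde W^1(2nT,\cdot),\tilde W^2(2nT,\cdot)\big)=(0,0)\quad\text{in } H^1_r(0,1)\times L^2(0,1),$$ $$\lim_{n\to+\infty}\big(\tilde Z_1(2nT),\tilde Z_2(2nT),\tilde Z_3(2nT)\big)=(0,0,0).$$
   Context: $H^1_r(0,1):=\{v\in H^1(0,1): v(1)=0\}$. The function $y$ is the output $y(t)=u_x(t,0)$, where $u$ is the unique solution in $C^1([0,T];H^1_0(0,1))\cap C^2([0,T];L^2(0,1))$ of $$u_{tt}-u_{xx}=q(x)\cos(\omega t)\ \text{on }(0,T)\times(0,1),\quad u(t,0)=u(t,1)=0,\quad u(0,x)=u_t(0,x)=0;$$ one has $y\in H^2(0,T)$, so that $y(0)$ and $\dot y(0)$ are well defined. The error system is considered in the class $(\tilde W^1,\tilde W^2)\in C([0,+\infty);H^2(0,1)\cap H^1_r(0,1))\times C([0,+\infty);H^1_r(0,1))$, $(\tilde Z_1,\tilde Z_2,\tilde Z_3)\in H^1([0,+\infty))\times L^2([0,+\infty))\times H^2([0,+\infty))$, in which it has a unique solution; the components are continuous in time across the switching times $kT$, so the values at times $2nT$ make sense. Subscripts $t,x$ denote partial derivatives. *)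

(* Defs.v *)
From HB Require Import structures.
From mathcomp Require Export all_boot all_order all_algebra.
From mathcomp Require Export all_classical all_reals all_analysis.
Export Order.TTheory GRing.Theory Num.Theory.
Export numFieldNormedType.Exports.

Set Implicit Arguments.
Unset Strict Implicit.
Unset Printing Implicit Defensive.

Local Open Scope classical_set_scope.
Local Open Scope ring_scope.

(** Elements of the Sobolev spaces on an open interval [D] are represented by
    functions [R -> R], whose values outside the closure of [D] are
    irrelevant. *)

Section sobolev.
Context {R : realType}.
Implicit Types (D : set R) (f g : R -> R).

Definition in_L2 D f : Prop := (f \_ D) \in Lfun (@lebesgue_measure R) 2%:E.

Definition L2norm D f : \bar R :=
  'N[@lebesgue_measure R]_2%:E [EFin \o (f \_ D)].

Definition C1c D (phi : R -> R) : Prop :=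
  [/\ forall x, derivable phi x 1,
      continuous (derive1 phi) &
      exists K : set R, [/\ compact K, K `<=` D & forall x, ~ K x -> phi x = 0]].

Definition weak_derivative D f g : Prop :=
  forall phi, C1c D phi ->
    Rintegral (@lebesgue_measure R) D (fun x => f x * derive1 phi x) =
    - Rintegral (@lebesgue_measure R) D (fun x => g x * phi x).

(** [f] is the representative of an element of H^1(D) that is continuous up to
    the boundary, so that its boundary values are meaningful; [f1] is any
    representative of its weak derivative. *)
Definition is_H1 D f f1 : Prop :=
  [/\ in_L2 D f, in_L2 D f1, weak_derivative D f f1 &
      {within closure D, continuous f}].

(** Here [f1] is the continuous representative of the first derivative. *)
Definition is_H2 D f f1 f2 : Prop := is_H1 D f f1 /\ is_H1 D f1 f2.

Definition H1norm D f f1 : \bar R := (L2norm D f + L2norm D f1)%E.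

End sobolev.

(** Functions of time with values in L^2(D), H^1(D) or H^2(D), written
    [F t x]; [I] is the set of times.  The limits are one-sided at the endpoints
    belonging to [I]. *)
Section time_dependent.
Context {R : realType}.
Implicit Types (I D : set R) (F G : R -> R -> R).

Definition C_L2 I D F : Prop :=
  forall t, I t -> in_L2 D (F t) /\
    (fun s => L2norm D (fun x => F s x - F t x)) @ within I (nbhs t) --> 0%E.

Definition C_H1 I D F Fx : Prop :=
  [/\ forall t, I t -> is_H1 D (F t) (Fx t), C_L2 I D F & C_L2 I D Fx].

Definition C_H2 I D F Fx Fxx : Prop := C_H1 I D F Fx /\ C_H1 I D Fx Fxx.

(** Strong derivative: [F] is differentiable in time on [I], as an
    L^2(D)-valued function, with derivative [G]. *)
Definition L2_time_derivative I D F G : Prop :=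
  forall t, I t ->
    (fun s => L2norm D (fun x => (s - t)^-1 * (F s x - F t x) - G t x))
      @ within I t^' --> 0%E.

End time_dependent.

Section systems.
Context {R : realType}.
Local Notation Om := (`]0, 1[%classic : set R).

(** q is in H^2(0,1) and in H^1_0(0,1). *)
Definition H2_H10 (q : R -> R) : Prop :=
  [/\ exists q1 q2, is_H2 Om q q1 q2, q 0 = 0 & q 1 = 0].

(** [u] is in C^1([0,T]; H^1_0(0,1)) and C^2([0,T]; L^2(0,1)) and solves
    u_tt - u_xx = q(x) cos(omega t) with homogeneous Dirichlet conditions and
    zero initial data; [ux], [uxx], [ut], [utx], [utt] are its derivatives.
    The derivative of [u] with values in H^1 is that of the pair [(u, ux)] with
    values in L^2.  That u(t, .) is in H^2(0,1) is a consequence of the equation;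
    it makes the trace u_x(t, 0) meaningful. *)
Record source_solution (T omega : R) (q : R -> R)
    (u ux uxx ut utx utt : R -> R -> R) : Prop := SourceSolution {
  src_u_C_H1 : C_H1 `[0, T] Om u ux ;
  src_ut_C_H1 : C_H1 `[0, T] Om ut utx ;
  src_utt_C_L2 : C_L2 `[0, T] Om utt ;
  src_deriv_u : L2_time_derivative `[0, T] Om u ut ;
  src_deriv_ux : L2_time_derivative `[0, T] Om ux utx ;
  src_deriv_ut : L2_time_derivative `[0, T] Om ut utt ;
  src_u_H2 : forall t : R, t \in `[0, T] -> is_H2 Om (u t) (ux t) (uxx t) ;
  src_bc : forall t : R, t \in `[0, T] -> u t 0 = 0 /\ u t 1 = 0 ;
  src_eq : forall t : R, t \in `]0, T[ ->
    {ae (@lebesgue_measure R), forall x, Om x ->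
        utt t x - uxx t x = q x * cos (omega * t)} ;
  src_init : forall x, Om x -> u 0 x = 0 /\ ut 0 x = 0
}.

Definition source_output (T omega : R) (q y : R -> R) : Prop :=
  exists u ux uxx ut utx utt : R -> R -> R,
    source_solution T omega q u ux uxx ut utx utt /\
    forall t : R, t \in `[0, T] -> y t = ux t 0.

Definition forward_times (T : R) (k : nat) : set R :=
  `](2 * k)%:R * T, (2 * k + 1)%:R * T[%classic.

Definition backward_times (T : R) (k : nat) : set R :=
  `](2 * k + 1)%:R * T, (2 * k + 2)%:R * T[%classic.

(** The forward/backward error system; [y0] and [dy0] stand for y(0) and y'(0).
    [W1x], [W1xx] and [W2x] are the space derivatives.  The equations for W are
    equalities of L^2(0,1)-valued functions on every open time interval, those
    for Z hold pointwise there, the right-hand sides being continuous. *)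
Record error_system (omega g1 g2 T : R) (q : R -> R) (y0 dy0 : R)
    (W1 W1x W1xx W2 W2x : R -> R -> R) (Z1 Z2 Z3 : R -> R) : Prop :=
  ErrorSystem {
  err_W1_class : C_H2 `[0, +oo[ Om W1 W1x W1xx ;
  err_W2_class : C_H1 `[0, +oo[ Om W2 W2x ;
  err_W_right : forall t : R, 0 <= t -> W1 t 1 = 0 /\ W2 t 1 = 0 ;
  err_Z1_class : exists dZ1, is_H1 `]0, +oo[ Z1 dZ1 ;
  err_Z2_class : in_L2 `]0, +oo[ Z2 /\ {within `[0, +oo[, continuous Z2} ;
  err_Z3_class : exists dZ3 ddZ3, is_H2 `]0, +oo[ Z3 dZ3 ddZ3 ;
  err_W_forward : forall k : nat,
    L2_time_derivative (forward_times T k) Om W1 W2 /\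
    L2_time_derivative (forward_times T k) Om W2 W1xx ;
  err_W_backward : forall k : nat,
    L2_time_derivative (backward_times T k) Om W1 (fun t x => - W2 t x) /\
    L2_time_derivative (backward_times T k) Om W2 (fun t x => - W1xx t x) ;
  err_W_left : forall t : R, 0 < t -> W1 t 0 = g1 * Z1 t + g1 * g2 * Z3 t ;
  err_W_init : forall x, Om x -> W1 0 x = - q x /\ W2 0 x = 0 ;
  err_Z_forward : forall (k : nat) (t : R), forward_times T k t ->
    is_derive t 1 Z1 (Z2 t - g2 * Z1 t) /\
    is_derive t 1 Z2 (- omega ^+ 2 * Z1 t + W1x t 0) ;
  err_Z_backward : forall (k : nat) (t : R), backward_times T k t ->
    is_derive t 1 Z1 (- Z2 t - g2 * Z1 t) /\
    is_derive t 1 Z2 (omega ^+ 2 * Z1 t - W1x t 0) ;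
  err_Z3 : forall t : R, 0 < t -> is_derive t 1 Z3 (Z1 t) ;
  err_Z_init : [/\ Z1 0 = - y0, Z2 0 = - dy0 & Z3 0 = 0]
}.

End systems.

(* Main.v *)
Require Import Defs.
From mathcomp Require Import all_boot all_order all_algebra.
From mathcomp Require Import all_classical all_reals all_analysis.
From mathcomp Require Import measurable_realfun ring lra.

Import Order.TTheory GRing.Theory Num.Theory numFieldNormedType.Exports.

Set Implicit Arguments.
Unset Strict Implicit.
Unset Printing Implicit Defensive.

Local Open Scope classical_set_scope.
Local Open Scope ring_scope.

(** The proof rests on four facts.

    Energy.  Put [X = (W1_x, W2, Z1, Z2)] with the bilinear form
    [<X, X'> = int (W1_x W1_x' + W2 W2') + g1 (Z2 Z2' + omega^2 Z1 Z1')]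
    ([energy_form]).  On a forward interval [X' = (A - D) X] and on a backward
    one [X' = (- A - D) X], where [A] is skew-symmetric and [D >= 0] damps [Z1].
    Hence the energy [<X, X>] decreases, and the backward evolution over a time
    [T] is the adjoint of the forward one.

    Hankel structure.  With [X_n = X(2nT)] and [Y_n = X((2n+1)T)], adjointness
    gives [<X_(n+1), X_m> = <Y_n, Y_m>].  The right-hand side is symmetric in
    [n] and [m], so [<X_n, X_m>] depends on [n + m] only
    ([energy_form_hankel]); in particular [|X_n|^2 = <X_0, X_(2n)>].  Strong
    convergence to [0] is therefore a consequence of weak convergence to [0],
    tested against the single vector [X_0].

    Observability.  Over a window of length [2 <= T] the wave equation is tested
    against explicit waves [Psi(s + x) - Psi(s + 2 - x)] whose profile
    [psi = Psi'] vanishes on [[2, +oo[].  After an integration by parts in time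
    the unknown trace [W1_x(s, 0)] disappears, and the product of the test data
    with [X_m] is bounded by the [L^1] norm of [Z1] and [Z2] over the window
    [[2mT, 2mT + 2]] ([test_wave_cvg0]).  These norms tend to [0], because the
    solution class makes [Z1, Z2, Z3] square integrable on [[0, +oo[].  The
    initial velocity [W2(0)] is zero and [W1_x(0)] is continuous, so such test
    data approximate the wave component of [X_0], and may in addition be given
    the boundary value [g1 Z2(0)] that accounts for the term in [Z2]
    ([test_family]).  As [X_m] is bounded, [<X_0, X_m>] tends to [0].

    Remaining components.  [Z1(2nT)] and [Z3(2nT)] tend to [0] because these
    functions and their derivatives are small in [L^1] over a window
    ([window_value_cvg0]); [W1(2nT)] is controlled by its derivative, since
    [W1(t, 1) = 0].

    The energy identity needs no time derivative of [W1_x]: increments of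
    [int W1_x W1_x'] are integrated by parts in [x], so that only [W1], which is
    differentiable in time, gets differentiated ([wave_energy_derive]).  The
    rules of calculus for elements of [H^1(0,1)] are derived from the definition
    of the weak derivative by way of primitives ([is_H1_abs_cont],
    [abs_cont_parts]). *)

(** * Square integrable functions *)

Section L2.
Context {R : realType}.
Local Notation mu := (@lebesgue_measure R).
Implicit Types (D : set R) (f g h : R -> R).

Lemma in_L2_measurable D f : measurable D -> in_L2 D f -> measurable_fun D f.
Proof.
move=> mD; rewrite /in_L2 inE => /andP[/[!inE]/= mf _].
exact/(measurable_restrictT _ mD).
Qed.

Lemma in_L2_sqr_integrable D f : measurable D -> in_L2 D f ->
  mu.-integrable D (EFin \o (fun x => f x ^+ 2)).
Proof.
move=> mD /Lfun2_integrable_sqr.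
rewrite (_ : EFin \o _ = (EFin \o (fun x => f x ^+ 2)) \_ D).
  by move=> h; apply: (proj2 (integrable_mkcond _ _)) => //; exact: mD.
apply/funext => x /=; rewrite !patchE; case: ifPn => //= _.
by rewrite expr0n.
Qed.

Lemma L2normE D f : measurable D ->
  L2norm D f = ((\int[mu]_(x in D) (f x ^+ 2)%:E) `^ 2^-1)%E.
Proof.
move=> mD; rewrite /L2norm unlock; congr (_ `^ _)%E.
rewrite [RHS]integral_mkcond; apply: eq_integral => x _.
rewrite /= !patchE; case: ifPn => //= _.
  by rewrite powR_mulrn// -normrX ger0_norm ?sqr_ge0.
by rewrite normr0 powR0.
Qed.

Lemma in_L2_intro D f : measurable D -> measurable_fun D f ->
  mu.-integrable D (EFin \o (fun x => f x ^+ 2)) -> in_L2 D f.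
Proof.
move=> mD mf fi; rewrite /in_L2 inE; apply/andP; split; rewrite inE/=.
  exact/(measurable_restrictT _ mD).
rewrite /finite_norm -/(L2norm D f) L2normE// poweR_lty//.
by rewrite integrable_lty.
Qed.

Lemma in_L2D D f g : in_L2 D f -> in_L2 D g -> in_L2 D (fun x => f x + g x).
Proof.
rewrite /in_L2 => fL gL.
rewrite (_ : _ \_ D = (f \_ D) + (g \_ D)); last first.
  by apply/funext => x; rewrite /= fctE !patchE; case: ifPn => //= _; rewrite addr0.
have p1 : (1 <= 2%:E :> \bar R)%E by rewrite lee_fin ler1n.
exact: (Lfun_addr_closed mu p1).2.
Qed.

Lemma in_L2Z D f a : in_L2 D f -> in_L2 D (fun x => a * f x).
Proof.
rewrite /in_L2 => fL.
rewrite (_ : _ \_ D = a *: (f \_ D)); last first.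
  by apply/funext => x; rewrite /= fctE !patchE; case: ifPn => //= _; rewrite scaler0.
have p1 : (1 <= 2%:E :> \bar R)%E by rewrite lee_fin ler1n.
have [L0 LZ] := @Lfun_submod_closed _ _ _ mu _ p1.
by rewrite -[_ *: _]addr0; apply: LZ.
Qed.
End L2.

(** * The inner product of L^2(0,1) *)

Section ip.
Context {R : realType}.
Local Notation mu := (@lebesgue_measure R).
Local Notation Om := (`]0, 1[%classic : set R).
Implicit Types (f g h : R -> R).

Definition ip f g : R := \int[mu]_(x in Om) (f x * g x).
Definition nrm f : R := Num.sqrt (ip f f).

Lemma measurable_Om : measurable Om.
Proof. exact: measurable_itv. Qed.
Hint Resolve measurable_Om : core.

Lemma mu_Om : mu Om = 1%:E.
Proof. by rewrite lebesgue_measure_itv/= lte_fin ltr01 sube0. Qed.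

Lemma in_L2M f g : in_L2 Om f -> in_L2 Om g ->
  mu.-integrable Om (EFin \o (fun x => f x * g x)).
Proof.
move=> fL gL; have /Lfun1_integrable := Lfun2_mul_Lfun1 fL gL.
rewrite (_ : EFin \o _ = (EFin \o (fun x => f x * g x)) \_ Om).
  by move=> h; apply: (proj2 (integrable_mkcond _ _)) => //; exact: measurable_Om.
apply/funext => x /=; rewrite !patchE; case: ifPn => //= _.
by rewrite mulr0.
Qed.

Lemma ipC f g : ip f g = ip g f.
Proof. by apply: eq_Rintegral => x _; rewrite mulrC. Qed.

Lemma eq_ip f f' g g' : (forall x, Om x -> f x = f' x) ->
  (forall x, Om x -> g x = g' x) -> ip f g = ip f' g'.
Proof.
move=> ff' gg'; apply: eq_Rintegral => x; rewrite inE => Ox.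
by rewrite ff' ?gg'.
Qed.

Lemma ipDl f g h : in_L2 Om f -> in_L2 Om g -> in_L2 Om h ->
  ip (fun x => f x + g x) h = ip f h + ip g h.
Proof.
move=> fL gL hL; rewrite /ip -RintegralD//; try exact: in_L2M.
by apply: eq_Rintegral => x _; rewrite mulrDl.
Qed.

Lemma ipZl a f h : in_L2 Om f -> in_L2 Om h ->
  ip (fun x => a * f x) h = a * ip f h.
Proof.
move=> fL hL; rewrite /ip -RintegralZl//; try exact: in_L2M.
by apply: eq_Rintegral => x _; rewrite mulrA.
Qed.

Lemma in_L2N D f : in_L2 D f -> in_L2 D (fun x => - f x).
Proof.
move=> fL; rewrite (_ : (fun x => _) = (fun x => -1 * f x)); first exact: in_L2Z.
by apply/funext => x; rewrite mulN1r.
Qed.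

Lemma in_L2B D f g : in_L2 D f -> in_L2 D g -> in_L2 D (fun x => f x - g x).
Proof. by move=> fL gL; apply: in_L2D => //; exact: in_L2N. Qed.

Lemma ipNl f h : in_L2 Om f -> in_L2 Om h ->
  ip (fun x => - f x) h = - ip f h.
Proof.
move=> fL hL; rewrite -mulN1r -ipZl//.
by apply: eq_ip => x _ //; rewrite mulN1r.
Qed.

Lemma ipBl f g h : in_L2 Om f -> in_L2 Om g -> in_L2 Om h ->
  ip (fun x => f x - g x) h = ip f h - ip g h.
Proof. by move=> fL gL hL; rewrite ipDl ?ipNl//; exact: in_L2N. Qed.

Lemma ipBr f g h : in_L2 Om f -> in_L2 Om g -> in_L2 Om h ->
  ip h (fun x => f x - g x) = ip h f - ip h g.
Proof. by move=> fL gL hL; rewrite ipC ipBl// ipC (ipC g). Qed.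

Lemma ipZr a f h : in_L2 Om f -> in_L2 Om h ->
  ip h (fun x => a * f x) = a * ip h f.
Proof. by move=> fL hL; rewrite ipC ipZl// ipC. Qed.

Lemma ipNr f h : in_L2 Om f -> in_L2 Om h ->
  ip h (fun x => - f x) = - ip h f.
Proof. by move=> fL hL; rewrite ipC ipNl// ipC. Qed.

Lemma ip_ge0 f : 0 <= ip f f.
Proof. by apply: Rintegral_ge0 => x _; rewrite -expr2 sqr_ge0. Qed.

Lemma nrm_ge0 f : 0 <= nrm f.
Proof. exact: sqrtr_ge0. Qed.

Lemma nrm_sqr f : nrm f ^+ 2 = ip f f.
Proof. by rewrite sqr_sqrtr// ip_ge0. Qed.

(** The discriminant of [t |-> ip (f - t g) (f - t g)] is nonpositive. *)
Lemma ler_normip f g : in_L2 Om f -> in_L2 Om g -> `|ip f g| <= nrm f * nrm g.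
Proof.
move=> fL gL; rewrite -sqrtrM ?ip_ge0// -sqrtr_sqr ler_wsqrtr//.
have pos t : 0 <= ip f f - 2 * t * ip f g + t ^+ 2 * ip g g.
  have := ip_ge0 (fun x => f x - t * g x).
  have tgL := in_L2Z t gL; have fgL := in_L2B fL tgL.
  rewrite ipBl// !ipBr// !ipZr// !ipZl// (ipC g f); lra.
have [g0|gN0] := eqVneq (ip g g) 0.
  have [->|fgN0] := eqVneq (ip f g) 0; first by rewrite expr0n/= mulr_ge0 ?ip_ge0.
  (* when [ip g g = 0] the polynomial is affine: this value makes it negative *)
  have := pos ((ip f f + 1) / (2 * ip f g)).
  rewrite g0 mulr0 addr0.
  rewrite (_ : 2 * _ * _ = ip f f + 1); last by field.
  by lra.
have gp : 0 < ip g g by rewrite lt_neqAle eq_sym gN0 ip_ge0.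
have := pos (ip f g / ip g g).
rewrite -(ler_pM2r gp) mul0r => h; rewrite -subr_ge0; apply: le_trans h _.
by rewrite le_eqVlt; apply/orP; left; apply/eqP; field.
Qed.

Lemma L2norm_nrm f : in_L2 Om f -> L2norm Om f = (nrm f)%:E.
Proof.
move=> fL; rewrite L2normE//.
have fi : (\int[mu]_(x in Om) (f x ^+ 2)%:E)%E \is a fin_num.
  by apply: integrable_fin_num => //; exact: in_L2_sqr_integrable.
rewrite -(fineK fi) poweR_EFin /nrm -powR12_sqrt ?ip_ge0//.
Qed.

Lemma ip_cvg (T : Type) (Fl : set_system T) (FF : Filter Fl)
    (F G : T -> R -> R) f g :
  (\forall s \near Fl, in_L2 Om (F s)) -> (\forall s \near Fl, in_L2 Om (G s)) ->
  in_L2 Om f -> in_L2 Om g ->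
  (fun s => nrm (fun x => F s x - f x)) @ Fl --> (0 : R) ->
  (fun s => nrm (fun x => G s x - g x)) @ Fl --> (0 : R) ->
  (fun s => ip (F s) (G s)) @ Fl --> ip f g.
Proof.
move=> FL GL fL gL Ff Gg.
apply/subr_cvg0; apply/norm_cvg0P.
pose B s := nrm (fun x => F s x - f x) * nrm (fun x => G s x - g x)
   + nrm (fun x => F s x - f x) * nrm g + nrm f * nrm (fun x => G s x - g x).
have B0 : B @ Fl --> (0 : R).
  rewrite [X in _ --> X](_ : _ = 0 * 0 + 0 * nrm g + nrm f * 0); last by lra.
  by apply: cvgD; [apply: cvgD; apply: cvgM => //; exact: cvg_cst|
    apply: cvgM => //; exact: cvg_cst].
apply: (@squeeze_cvgr _ _ _ _ (cst 0) B) => //; last exact: cvg_cst.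
near=> s.
have Fs : in_L2 Om (F s) by near: s.
have Gs : in_L2 Om (G s) by near: s.
have dF := in_L2B Fs fL; have dG := in_L2B Gs gL.
rewrite normr_ge0/= (_ : _ - _ = ip (fun x => F s x - f x) (fun x => G s x - g x)
  + ip (fun x => F s x - f x) g + ip f (fun x => G s x - g x)); last first.
  by rewrite !ipBl// !ipBr//; lra.
rewrite (le_trans (ler_normD _ _))// lerD ?ler_normip//.
by rewrite (le_trans (ler_normD _ _))// lerD ?ler_normip.
Unshelve. all: by end_near. Qed.
End ip.

(** * Derivatives of real functions *)

Section calculus.
Context {R : realType}.
Implicit Types (f g : R -> R).

Lemma dnbhs_ball (t : R) (P : R -> Prop) :
  (\forall s \near t^', P s) <->
  exists2 e, 0 < e & forall s, s != t -> `|s - t| < e -> P s.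
Proof.
split.
  move=> [e /= e0 H]; exists e => // s st se; apply: H => //=.
  by rewrite distrC.
move=> [e e0 H]; exists e => // s /= se st; apply: H => //.
by rewrite distrC.
Qed.

(** Expresses derivatives by the same quotients as the derivatives in time of
    functions with values in [L^2], so that the two can be combined. *)
Lemma is_derive_quot f (t l : R) :
  is_derive t 1 f l <-> (fun s => (s - t)^-1 * (f s - f t)) @ t^' --> l.
Proof.
have E : ((fun s => (s - t)^-1 * (f s - f t)) @ t^' --> l) <->
    ((fun h => h^-1 *: ((f \o shift t) (h *: 1) - f t)) @ 0^' --> l).
  split => /cvgrPdist_lt H; apply/cvgrPdist_lt => e e0.
    have /dnbhs_ball[d d0 Hd] := H e e0.
    apply/dnbhs_ball; exists d => // s s0; rewrite subr0 => sd.
    have := Hd (s + t); rewrite addrK /= scaler1; apply => //.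
    by rewrite -subr_eq0 addrK.
  have /dnbhs_ball[d d0 Hd] := H e e0.
  apply/dnbhs_ball; exists d => // s st sd.
  have := Hd (s - t); rewrite subr0 /= scaler1 subrK; apply => //.
  by rewrite subr_eq0.
split.
  by move=> [dx dl]; apply/E; rewrite -dl; exact: dx.
move/E => H; apply: DeriveDef; first by apply/cvg_ex; exists l.
exact/cvg_lim.
Qed.

(** A quadratic remainder gives the derivative even of functions defined by
    cases, such as [ramp2]. *)
Lemma is_derive_quad f (t l K : R) :
  (forall s, `|f s - f t - l * (s - t)| <= K * (s - t) ^+ 2) ->
  is_derive t 1 f l.
Proof.
move=> H; apply/is_derive_quot/cvgrPdist_lt => e e0.
apply/dnbhs_ball; exists (e / (`|K| + 1)).
  by rewrite divr_gt0// ltr_wpDl.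
move=> s st sd; have st0 : s - t != 0 by rewrite subr_eq0.
have -> : l - (s - t)^-1 * (f s - f t) = - ((s - t)^-1 * (f s - f t - l * (s - t))).
  by field.
rewrite normrN normrM normfV mulrC ltr_pdivrMr ?normr_gt0//.
apply: le_lt_trans (H s) _.
have : K * (s - t) ^+ 2 <= `|K| * `|s - t| ^+ 2.
  by rewrite real_normK ?num_real// ler_wpM2r ?sqr_ge0// ler_norm.
move=> /le_lt_trans; apply.
rewrite expr2 mulrA ltr_pM2r ?normr_gt0//.
move: sd; rewrite ltr_pdivlMr ?ltr_wpDl// => sd.
have : `|K| * `|s - t| <= `|s - t| * (`|K| + 1).
  by rewrite mulrDr mulr1 mulrC lerDl.
by move=> /le_lt_trans; apply.
Qed.

Lemma is_derive_cts f (t l : R) : is_derive t 1 f l -> {for t, continuous f}.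
Proof. by move=> [dx _]; exact/differentiable_continuous/derivable1_diffP. Qed.

Lemma is_derive_affine f (a b t l : R) : is_derive (a * t + b) 1 f l ->
  is_derive t 1 (fun s => f (a * s + b)) (a * l).
Proof.
move=> df.
have da : is_derive t 1 (fun s : R => a * s + b) a.
  apply: (@is_derive_quad _ _ _ 0) => s.
  by rewrite (_ : _ - _ - _ = 0) ?normr0 ?mul0r//; ring.
by rewrite mulrC; exact: (@is_derive1_comp _ f (fun s => a * s + b) t l a df da).
Qed.

Lemma le_of_derive_le0 f df (a b : R) : a <= b ->
  {within `[a, b], continuous f} ->
  (forall t, a < t < b -> is_derive t 1 f (df t)) ->
  (forall t, a < t < b -> df t <= 0) -> f b <= f a.
Proof.
move=> ab cf ddf le0.
have [t tab] : exists2 c, c \in `[a, b]%R & f b - f a = (if a < c < b then df c else 0) * (b - a).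
  move: ab; rewrite le_eqVlt => /predU1P[ab|ab].
    by exists a; rewrite ?in_itv/= ab ?lexx// !subrr mulr0.
  have D x : x \in `]a, b[%R -> is_derive x 1 f (df x) by rewrite in_itv/=; exact: ddf.
  have [c cab E] := MVT ab D cf.
  by exists c; [exact: subset_itv_oo_cc|move: cab; rewrite in_itv/= => ->].
have h : (if a < t < b then df t else 0) * (b - a) <= 0.
  by rewrite mulr_le0_ge0 ?subr_ge0//; case: ifPn => // /le0.
by move=> E; rewrite -subr_le0 E.
Qed.

Lemma le_of_derive_ge0 f df (a b : R) : a <= b ->
  {within `[a, b], continuous f} ->
  (forall t, a < t < b -> is_derive t 1 f (df t)) ->
  (forall t, a < t < b -> 0 <= df t) -> f a <= f b.
Proof.
move=> ab cf ddf ge0; rewrite -lerN2.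
apply: (@le_of_derive_le0 (fun x => - f x) (fun x => - df x) a b ab) => //.
- by move=> x; exact/continuousN/cf.
- by move=> t /ddf d; exact: is_deriveN.
- by move=> t /ge0; rewrite oppr_le0.
Qed.

Lemma eq_of_derive0 f (a b : R) : a <= b -> {within `[a, b], continuous f} ->
  (forall t, a < t < b -> is_derive t 1 f 0) -> f b = f a.
Proof.
move=> ab cf ddf; apply/eqP; rewrite eq_le; apply/andP; split.
  exact: (le_of_derive_le0 ab cf ddf).
exact: (le_of_derive_ge0 ab cf ddf).
Qed.
End calculus.

(** * Integrals of continuous and of bounded functions *)

Section integrals.
Context {R : realType}.
Local Notation mu := (@lebesgue_measure R).
Local Notation Om := (`]0, 1[%classic : set R).
Implicit Types (f g F : R -> R).

Lemma integrable_within_itvoo f (a b : R) :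
  {within `[a, b], continuous f} -> mu.-integrable `]a, b[ (EFin \o f).
Proof.
move=> cf.
apply: (@integrableS _ _ _ mu `[a, b]) => //; first exact: subset_itv_oo_cc.
exact: continuous_compact_integrable (@segment_compact _ _ _) cf.
Qed.

Lemma Rintegral_itvoo_derive F f (a b : R) : a < b ->
  (forall x : R, is_derive x 1 F (f x)) -> continuous f ->
  \int[mu]_(x in `]a, b[) f x = F b - F a.
Proof.
move=> ab dF cf.
have wcf : {within `[a, b], continuous f} by exact: continuous_subspaceT.
have cc : mu.-integrable `[a, b] (EFin \o f).
  exact: continuous_compact_integrable (@segment_compact _ _ _) wcf.
rewrite Rintegral_itv_obnd_cbnd; last exact: integrable_within_itvoo.
rewrite Rintegral_itv_bndo_bndc; last first.
  apply: (@integrableS _ _ _ mu `[a, b]) => //.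
  by apply: subset_itvl; rewrite bnd_simp.
rewrite /Rintegral (@continuous_FTC2 _ f F)//.
- have cF : continuous F by move=> x; exact: is_derive_cts (dF x).
  split; first by move=> x _; exact: ex_derive.
    exact/cvg_at_right_filter/cF.
  exact/cvg_at_left_filter/cF.
- by move=> x _; rewrite derive1E derive_val.
Qed.

Lemma in_L2_bounded f (c : R) : measurable_fun Om f ->
  (forall x, Om x -> `|f x| <= c) -> in_L2 Om f.
Proof.
move=> mf fc; apply: in_L2_intro => //.
apply: measurable_bounded_integrable => //.
- by rewrite [ltLHS]mu_Om ltey.
- by apply: measurable_funX.
- exists (c ^+ 2); split; rewrite ?num_real// => y cy x Ox.
  have c0 : 0 <= c by exact: le_trans (fc x Ox).
  by rewrite /= normrX (le_trans _ (ltW cy))// ler_pXn2r ?nnegrE ?fc.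
Qed.

Lemma in_L2_within f : {within `[0, 1], continuous f} -> in_L2 Om f.
Proof.
move=> cf.
have [c [_ cb]] := compact_bounded (continuous_compact cf (@segment_compact _ 0 1)).
have mf : measurable_fun (`[0, 1]%classic : set R) f by exact: subspace_continuous_measurable_fun.
apply: (@in_L2_bounded _ (`|c| + 1)).
  by apply: measurable_funS mf => //; exact: subset_itv_oo_cc.
move=> x Ox; apply: (cb (`|c| + 1)); first by rewrite ltr_pwDr// ler_norm.
by exists x => //; exact: subset_itv_oo_cc.
Qed.

Lemma in_L2_continuous f : continuous f -> in_L2 Om f.
Proof. by move=> cf; apply: in_L2_within; exact: continuous_subspaceT. Qed.

Lemma nrm_le f (c : R) : 0 <= c -> in_L2 Om f ->
  (forall x, Om x -> `|f x| <= c) -> nrm f <= c.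
Proof.
move=> c0 fL fc; rewrite -(ger0_norm c0) -sqrtr_sqr ler_wsqrtr//.
have -> : c ^+ 2 = \int[mu]_(x in Om) (c ^+ 2).
  by rewrite Rintegral_cst// [X in fine X]mu_Om mulr1.
apply: le_Rintegral => //; first exact: in_L2M.
  apply: (@integrable_within_itvoo (fun=> c ^+ 2)).
  by apply: continuous_subspaceT => x; exact: cvg_cst.
by move=> x Ox; rewrite -expr2 -real_normK ?num_real// ler_pXn2r ?nnegrE ?fc.
Qed.

Lemma in_L2_cst (c : R) : in_L2 Om (fun=> c).
Proof. by apply: in_L2_continuous => x; exact: cvg_cst. Qed.

Lemma in_L2_indic (A : set R) : measurable A -> in_L2 Om (\1_A : R -> R).
Proof.
move=> mA; apply: (@in_L2_bounded _ 1); first exact: measurable_indic.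
by move=> x _; rewrite indicE; case: (_ \in _); rewrite ?normr1 ?normr0.
Qed.
End integrals.

(** * Smooth cut-off functions *)

Section bump.
Context {R : realType}.
Implicit Types (u v a d x : R).

(** A [C^1] function vanishing on the left of [0]; combinations of its
    translates give [step] without gluing formulas together. *)
Definition ramp2 u : R := Num.max u 0 ^+ 2.

Lemma ramp2_quad u v :
  `|ramp2 v - ramp2 u - 2 * Num.max u 0 * (v - u)| <= (v - u) ^+ 2.
Proof.
have s0 := sqr_ge0 (v - u); rewrite /ramp2 ler_norml; apply/andP.
case: (leP u 0) => hu; case: (leP v 0) => hv; rewrite ?expr0n/=; split; try nra.
Qed.

(** The [C^1] piecewise quadratic transition from [0] to [1] on [[0, 1]]; its
    derivative is [tent]. *)
Definition step u : R := 2 * ramp2 u - 4 * ramp2 (u - 2^-1) + 2 * ramp2 (u - 1).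
Definition tent u : R :=
  4 * Num.max u 0 - 8 * Num.max (u - 2^-1) 0 + 4 * Num.max (u - 1) 0.

Lemma is_derive_step u : is_derive u 1 step (tent u).
Proof.
apply: (@is_derive_quad _ _ _ _ 8) => v.
have h1 := ramp2_quad u v; have h2 := ramp2_quad (u - 2^-1) (v - 2^-1).
have h3 := ramp2_quad (u - 1) (v - 1).
move: h1 h2 h3; rewrite !ler_norml /step /tent.
rewrite (_ : v - 2^-1 - (u - 2^-1) = v - u); last by lra.
rewrite (_ : v - 1 - (u - 1) = v - u); last by lra.
by move=> /andP[? ?] /andP[? ?] /andP[? ?]; apply/andP; split; nra.
Qed.

Lemma continuous_tent : continuous tent.
Proof.
have cmax (c : R) : continuous (fun u : R => Num.max (u - c) 0).
  move=> u; apply: (@continuous_max _ _ (fun u : R => u - c) (fun=> 0)); last exact: cvg_cst.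
  by apply: cvgB; [exact: cvg_id|exact: cvg_cst].
have c0 : continuous (fun u : R => Num.max u 0).
  rewrite (_ : (fun u => _) = (fun u => Num.max (u - 0) 0)); first exact: cmax.
  by apply/funext => w; rewrite subr0.
have c1 := cmax 1; have c2 := cmax 2^-1.
move=> u; rewrite /tent; apply: cvgD; [apply: cvgB|];
  (apply: cvgM; [exact: cvg_cst|]); [|exact: c2|exact: c1].
exact: c0.
Qed.

Lemma step_le0 u : u <= 0 -> step u = 0.
Proof.
by move=> u0; rewrite /step /ramp2 !max_r ?expr0n/= ?mulr0 ?subr0 ?addr0//; lra.
Qed.

Lemma step_ge1 u : 1 <= u -> step u = 1.
Proof. by move=> u0; rewrite /step /ramp2 !max_l; lra. Qed.

Lemma step_itv u : 0 <= step u <= 1.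
Proof.
have [u0|u0] := leP u 0; first by rewrite step_le0// lexx ler01.
have [u1|u1] := leP 1 u; first by rewrite step_ge1// lexx ler01.
rewrite /step /ramp2 (@max_l _ _ u) ?(@max_r _ _ (u - 1)); try lra.
have [u2|u2] := leP (u - 2^-1) 0; apply/andP; split; nra.
Qed.

Lemma tent_le0 u : u <= 0 -> tent u = 0.
Proof. by move=> u0; rewrite /tent !max_r ?mulr0 ?subr0 ?addr0//; lra. Qed.

Lemma tent_ge1 u : 1 <= u -> tent u = 0.
Proof. by move=> u0; rewrite /tent !max_l; lra. Qed.

Lemma tent_ge0 u : 0 <= tent u.
Proof.
have [u0|u0] := leP u 0; first by rewrite tent_le0.
have [u1|u1] := leP 1 u; first by rewrite tent_ge1.
rewrite /tent (@max_l _ _ u) ?(@max_r _ _ (u - 1)); try lra.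
by have [u2|u2] := leP (u - 2^-1) 0; nra.
Qed.

(** As [d] tends to [0] this is an approximation of the indicator of [x > a], and
    its derivative [dcutoff] is one of the Dirac mass at [a]. *)
Definition cutoff a d x : R := step (d^-1 * x + - (a / d)).
Definition dcutoff a d x : R := d^-1 * tent (d^-1 * x + - (a / d)).

Lemma is_derive_cutoff a d x : is_derive x 1 (cutoff a d) (dcutoff a d x).
Proof. exact/is_derive_affine/is_derive_step. Qed.

Lemma continuous_dcutoff a d : continuous (dcutoff a d).
Proof.
move=> x; apply: cvgM; first exact: cvg_cst.
apply: (@cvg_comp _ _ _ (fun x => d^-1 * x + - (a / d)) tent); last exact: continuous_tent.
by apply: cvgD; [apply: cvgM; [exact: cvg_cst|exact: cvg_id]|exact: cvg_cst].
Qed.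

Lemma cutoffE a d x : d^-1 * x + - (a / d) = (x - a) / d.
Proof. by rewrite mulrBl mulrC. Qed.

Lemma cutoff_left a d x : 0 < d -> x <= a -> cutoff a d x = 0.
Proof.
by move=> d0 xa; rewrite /cutoff cutoffE step_le0// pmulr_lle0 ?invr_gt0// subr_le0.
Qed.

Lemma cutoff_right a d x : 0 < d -> a + d <= x -> cutoff a d x = 1.
Proof.
by move=> d0 xa; rewrite /cutoff cutoffE step_ge1// ler_pdivlMr// mul1r lerBrDl.
Qed.

Lemma dcutoff_left a d x : 0 < d -> x <= a -> dcutoff a d x = 0.
Proof.
by move=> d0 xa; rewrite /dcutoff cutoffE tent_le0 ?mulr0// pmulr_lle0 ?invr_gt0// subr_le0.
Qed.

Lemma dcutoff_right a d x : 0 < d -> a + d <= x -> dcutoff a d x = 0.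
Proof.
by move=> d0 xa; rewrite /dcutoff cutoffE tent_ge1 ?mulr0// ler_pdivlMr// mul1r lerBrDl.
Qed.

Lemma dcutoff_ge0 a d x : 0 < d -> 0 <= dcutoff a d x.
Proof. by move=> d0; rewrite mulr_ge0 ?tent_ge0// invr_ge0 ltW. Qed.
End bump.

(** * Weak derivatives have increments given by integrals *)

Section sobolev1.
Context {R : realType}.
Local Notation mu := (@lebesgue_measure R).
Local Notation Om := (`]0, 1[%classic : set R).
Implicit Types (f g F : R -> R).

Lemma within_cvg_seq (A : set R) f (x : R) (u : nat -> R) :
  {within A, continuous f} -> A x -> (forall n, A (u n)) ->
  u @ \oo --> x -> (f \o u) @ \oo --> f x.
Proof.
move=> /subspace_continuousP cf Ax Au ux.
apply: cvg_trans (cf x Ax) => P /= PP.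
have : \forall n \near \oo, (A (u n) -> P (f (u n))) by exact: ux PP.
by apply: filterS => n; exact.
Qed.

Lemma nrm_dominated_cvg0 (e : nat -> R -> R) (c : R) :
  (forall n, measurable_fun Om (e n)) ->
  (forall n x, Om x -> `|e n x| <= c) ->
  (forall x, Om x -> e ^~ x @ \oo --> (0 : R)) ->
  (fun n => nrm (e n)) @ \oo --> (0 : R).
Proof.
move=> me ec e0.
have eL n : in_L2 Om (e n) by apply: (@in_L2_bounded _ _ c) => // x; exact: ec.
have h : (\int[mu]_(x in Om) (e n x * e n x)%:E)%E @[n --> \oo] -->
    (\int[mu]_(x in Om) (0 : \bar R))%E.
  apply: (@dominated_cvg _ _ _ mu Om _ _ (fun=> 0%E) (fun=> (c ^+ 2)%:E)) => //.
  - by move=> n; exact: (measurable_int mu (in_L2M (eL n) (eL n))).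
  - move=> x Ox; apply: cvg_EFin; first by apply: nearW.
    by rewrite -(mulr0 0); apply: cvgM; exact: e0.
  - apply: (@integrable_within_itvoo _ (fun=> c ^+ 2)).
    by apply: continuous_subspaceT => x; exact: cvg_cst.
  - move=> n x Ox; rewrite lee_fin -expr2 normrX ler_pXn2r ?nnegrE ?ec//.
    exact: le_trans (ec n x Ox).
have ip0 : (fun n => ip (e n) (e n)) @ \oo --> (0 : R).
  by move: h; rewrite integral0 => /fine_cvg.
rewrite -(sqrtr0 R); apply: (cvg_comp _ _ ip0); exact: sqrt_continuous.
Qed.

Lemma subset_closure_Om : `[0, 1]%classic `<=` closure Om.
Proof.
have -> : Om = ball (2^-1 : R) 2^-1.
  by rewrite ball_itv subrr (_ : 2^-1 + 2^-1 = 1 :> R)//; lra.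
rewrite closure_ballE// closed_ball_itv//.
by move=> x /=; rewrite !in_itv/=; lra.
Qed.

Lemma is_H1_within f f1 : is_H1 Om f f1 -> {within `[0, 1], continuous f}.
Proof. by case=> _ _ _; apply: continuous_subspaceW; exact: subset_closure_Om. Qed.

Lemma ip_dcutoff1 (a d : R) : 0 < d -> 0 <= a -> a + d <= 1 ->
  ip (fun=> 1) (dcutoff a d) = 1.
Proof.
move=> d0 a0 ad; rewrite /ip.
under eq_Rintegral do rewrite mul1r.
rewrite (Rintegral_itvoo_derive ltr01 (is_derive_cutoff a d))//.
  by rewrite cutoff_right// cutoff_left// subr0.
exact: continuous_dcutoff.
Qed.

(** The derivative of a cut-off is nonnegative, has integral [1] and lives on
    [[a, a + d]]. *)
Lemma ip_dcutoff_close f (a d c e : R) : in_L2 Om f ->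
  0 < d -> 0 <= a -> a + d <= 1 ->
  (forall x, a <= x <= a + d -> `|f x - c| <= e) ->
  `|ip f (dcutoff a d) - c| <= e.
Proof.
move=> fL d0 a0 ad fe.
have kL : in_L2 Om (dcutoff a d) by exact/in_L2_continuous/continuous_dcutoff.
have cL := @in_L2_cst R c; have oL := @in_L2_cst R 1.
have -> : ip f (dcutoff a d) - c = ip (fun x => f x - c) (dcutoff a d).
  rewrite ipBl//; congr (_ - _).
  rewrite -[LHS]mulr1 -(ip_dcutoff1 d0 a0 ad) -ipZl//.
  by apply: eq_ip => // x _; rewrite mulr1.
have fcL := in_L2B fL cL.
have eE : e = \int[mu]_(x in Om) (e * (1 * dcutoff a d x)).
  by rewrite RintegralZl//; [rewrite [X in _ * X]ip_dcutoff1// mulr1|exact: in_L2M].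
rewrite [leRHS]eE; apply: le_trans (le_normr_Rintegral _ _) _ => //; first exact: in_L2M.
apply: le_Rintegral => //.
- exact: integrable_norm (in_L2M fcL kL).
- rewrite (_ : _ \o _ = EFin \o (fun x => e * 1 * dcutoff a d x)); last first.
    by apply/funext => x /=; rewrite mulrA.
  by apply: in_L2M => //; exact: in_L2_cst.
- move=> x _; rewrite mul1r normrM (ger0_norm (dcutoff_ge0 a x d0)).
  have [xa|ax] := leP x a; first by rewrite dcutoff_left ?mulr0.
  have [xa|xa] := leP (a + d) x; first by rewrite dcutoff_right ?mulr0.
  by rewrite ler_wpM2r ?dcutoff_ge0// fe// !ltW.
Qed.

(** The difference of two cut-offs is a [C^1] function with compact support in
    the open interval, hence a legitimate test function. *)
Lemma H1_cutoff f f1 (a b d : R) : is_H1 Om f f1 -> 0 < a -> a < b -> 0 < d ->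
  b + d < 1 ->
  ip f (dcutoff a d) - ip f (dcutoff b d) =
    - ip f1 (fun x => cutoff a d x - cutoff b d x).
Proof.
move=> [fL f1L wd _] a0 ab d0 bd.
have kL c : in_L2 Om (dcutoff c d) by exact/in_L2_continuous/continuous_dcutoff.
have dphi (x : R) : is_derive x 1 (fun x => cutoff a d x - cutoff b d x)
    (dcutoff a d x - dcutoff b d x).
  by apply: is_deriveB; exact: is_derive_cutoff.
rewrite -ipBr//.
have D1 : derive1 (fun x => cutoff a d x - cutoff b d x)
    = (fun x => dcutoff a d x - dcutoff b d x).
  by apply/funext => x; rewrite derive1E derive_val.
rewrite /ip -wd ?D1//; split.
- by move=> x; exact: ex_derive.
- by rewrite D1 => x; apply: cvgB; exact: continuous_dcutoff.
- exists `[a, b + d]%classic; split; first exact: segment_compact.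
    by move=> x /=; rewrite !in_itv/= => /andP[? ?]; apply/andP; split; lra.
  move=> x /=; rewrite in_itv/= => /negP; rewrite negb_and -!ltNge => /orP[xa|xb].
    by rewrite !cutoff_left ?subrr//; lra.
  by rewrite !cutoff_right ?subrr//; lra.
Qed.

Definition itv_ind (a b : R) : R -> R := \1_(`]a, b]%classic).

Lemma itv_indE a b x : itv_ind a b x = (a < x <= b)%R%:R.
Proof. by rewrite /itv_ind indicE; congr (_%:R); rewrite mem_setE in_itv. Qed.

Lemma in_L2_itv_ind a b : in_L2 Om (itv_ind a b).
Proof. exact: in_L2_indic. Qed.

Lemma cvg_harmonicM (d : R) : (fun n => d / n.+1%:R) @ \oo --> (0 : R).
Proof.
rewrite -(mulr0 d); apply: cvgM; first exact: cvg_cst.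
exact: cvg_harmonic.
Qed.

Lemma cutoff_itv (a d x : R) : 0 <= cutoff a d x <= 1.
Proof. exact: step_itv. Qed.

Lemma cvg_cutoff (a d x : R) : 0 < d ->
  (fun n => cutoff a (d / n.+1%:R) x) @ \oo --> ((a < x)%R%:R : R).
Proof.
move=> d0; apply: cvg_near_cst.
have dn n : 0 < d / n.+1%:R by rewrite divr_gt0.
have [ax|xa] := ltP a x; last by apply: nearW => n; rewrite cutoff_left.
have xa : 0 < x - a by rewrite subr_gt0.
have /cvgrPdist_lt/(_ _ xa) := cvg_harmonicM d.
apply: filterS => n; rewrite sub0r normrN gtr0_norm// => h.
by rewrite cutoff_right// -lerBrDl ltW.
Qed.

Lemma continuous_cutoff (a d : R) : continuous (cutoff a d).
Proof. by move=> x; exact: is_derive_cts (is_derive_cutoff a d x). Qed.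

(** Limit of [H1_cutoff] as [d] tends to [0]: on the left the continuity of [f]
    yields values of [f], on the right dominated convergence applies. *)
Lemma H1_increment f f1 (a b : R) : is_H1 Om f f1 -> 0 < a -> a < b -> b < 1 ->
  f b - f a = ip f1 (itv_ind a b).
Proof.
move=> H a0 ab b1; have [fL f1L _ _] := H.
have cf := is_H1_within H.
pose d0 := (1 - b) / 2; have d0p : 0 < d0 by rewrite /d0; lra.
pose d n : R := d0 / n.+1%:R.
have dp n : 0 < d n by rewrite divr_gt0.
have dd0 n : d n <= d0 by rewrite ler_pdivrMr// ler_peMr ?ler1n// ltW.
have kcvg c : 0 < c -> c <= b -> (fun n => ip f (dcutoff c (d n))) @ \oo --> f c.
  move=> c0 cb; have c01 : c \in `[0, 1] by rewrite in_itv/=; lra.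
  move/subspace_continuousP : (cf) => /(_ c c01)/cvgrPdist_le cfc.
  apply/cvgrPdist_le => e e0.
  have [r r0 Hr] := cfc e e0.
  have /cvgrPdist_lt/(_ _ r0) := cvg_harmonicM d0.
  apply: filterS => n; rewrite sub0r normrN gtr0_norm; last exact: dp.
  move=> dr.
  rewrite distrC; apply: ip_dcutoff_close => //; first exact: ltW.
    by have := dd0 n; rewrite /d0; lra.
  move=> x /andP[cx xc]; rewrite distrC; apply: Hr => /=.
    by rewrite distrC ger0_norm ?subr_ge0//; rewrite -/(d n) in dr; lra.
  by rewrite in_itv/=; have := dd0 n; rewrite /d0; lra.
have phiL n c : in_L2 Om (cutoff c (d n)) by exact/in_L2_continuous/continuous_cutoff.
have rcvg : (fun n => - ip f1 (fun x => cutoff a (d n) x - cutoff b (d n) x)) @ \oo -->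
    - ip f1 (itv_ind a b).
  apply: cvgN; apply: ip_cvg => //.
  - by apply: nearW => n.
  - by apply: nearW => n; exact: in_L2B.
  - exact: in_L2_itv_ind.
  - rewrite (_ : (fun n => _) = (fun=> 0)); first exact: cvg_cst.
    by apply/funext => n; rewrite /nrm ipBl ?subrr ?sqrtr0//; exact: in_L2B.
  - apply: (@nrm_dominated_cvg0 _ 2).
    + move=> n; apply: in_L2_measurable => //; apply: in_L2B; last exact: in_L2_itv_ind.
      exact: in_L2B.
    + move=> n x _; rewrite itv_indE.
      have /andP[? ?] := cutoff_itv a (d n) x; have /andP[? ?] := cutoff_itv b (d n) x.
      rewrite ler_norml; case: (a < x <= b); rewrite /= ?mulr1n ?mulr0n.
        by apply/andP; split; lra.
      by apply/andP; split; lra.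
    + move=> x _; rewrite [X in _ --> X](_ : _ = (a < x)%R%:R - (b < x)%R%:R - itv_ind a b x).
        by apply: cvgB; [apply: cvgB; exact: cvg_cutoff|exact: cvg_cst].
      rewrite itv_indE; have [ax|xa] := ltP a x; have [bx|xb] := ltP b x; rewrite /= ?mulr1n ?mulr0n; lra.
have lcvg : (fun n => ip f (dcutoff a (d n)) - ip f (dcutoff b (d n))) @ \oo --> f a - f b.
  by apply: cvgB; apply: kcvg => //; [exact: ltW|exact: lt_trans ab].
have E : (fun n => ip f (dcutoff a (d n)) - ip f (dcutoff b (d n))) =
    (fun n => - ip f1 (fun x => cutoff a (d n) x - cutoff b (d n) x)).
  apply/funext => n; apply: H1_cutoff => //.
  by apply: le_lt_trans (_ : b + d0 < 1); [rewrite lerD2l|rewrite /d0; lra].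
rewrite E in lcvg.
have h : f a - f b = - ip f1 (itv_ind a b) by exact: (cvg_unique _ lcvg rcvg).
by lra.
Qed.
End sobolev1.

(** * Integration by parts in H^1(0,1) *)

Section abs_cont.
Context {R : realType}.
Local Notation mu := (@lebesgue_measure R).
Local Notation Om := (`]0, 1[%classic : set R).
Implicit Types (f g F : R -> R).

(** The working form of [is_H1] on the unit interval: [f] is a primitive of [f1],
    up to the boundary. *)
Definition abs_cont f f1 : Prop := [/\ in_L2 Om f, in_L2 Om f1 &
  forall x, 0 <= x <= 1 -> f x = f 0 + ip f1 (itv_ind 0 x)].

Lemma ip_itv_ind_cvg f1 (a b : nat -> R) (a' b' : R) : in_L2 Om f1 ->
  (forall x, Om x -> (fun n => itv_ind (a n) (b n) x) @ \oo --> itv_ind a' b' x) ->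
  (fun n => ip f1 (itv_ind (a n) (b n))) @ \oo --> ip f1 (itv_ind a' b').
Proof.
move=> f1L H; apply: ip_cvg => //.
- by apply: nearW => n.
- by apply: nearW => n; exact: in_L2_itv_ind.
- exact: in_L2_itv_ind.
- rewrite (_ : (fun n => _) = (fun=> 0)); first exact: cvg_cst.
  by apply/funext => n; rewrite /nrm ipBl ?subrr ?sqrtr0//; exact: in_L2B.
- apply: (@nrm_dominated_cvg0 _ _ 1).
  + by move=> n; apply: in_L2_measurable => //; apply: in_L2B; exact: in_L2_itv_ind.
  + move=> n x _; rewrite !itv_indE; case: (a n < x <= b n); case: (a' < x <= b');
    by rewrite /= ?mulr1n ?mulr0n ?subrr ?subr0 ?sub0r ?normrN ?normr1 ?normr0.
  + by move=> x Ox; apply/subr_cvg0; exact: H.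
Qed.

Lemma ip0r f : ip f (fun=> 0) = 0.
Proof.
rewrite /ip -[RHS](mul0r (fine (mu Om))) -Rintegral_cst//.
by apply: eq_Rintegral => x _; rewrite mulr0.
Qed.

Lemma cvg_near_seq (u : nat -> R) (x y : R) : u @ \oo --> x -> x < y ->
  \forall n \near \oo, u n < y.
Proof. by move=> ux xy; exact: (cvgr_lt x ux). Qed.

(** [H1_increment] gives the formula between interior points; both sides are
    continuous up to the end points. *)
Lemma is_H1_abs_cont f f1 : is_H1 Om f f1 -> abs_cont f f1.
Proof.
move=> H; have [fL f1L _ _] := H; split => // x /andP[x0 x1].
have cf := is_H1_within H.
have left y : 0 < y -> y < 1 -> f y = f 0 + ip f1 (itv_ind 0 y).
  move=> y0 y1; pose a n : R := y / n.+2%:R.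
  have a0 n : 0 < a n by rewrite divr_gt0.
  have ay n : a n < y by rewrite ltr_pdivrMr// ltr_pMr// ltr1n.
  have acvg : a @ \oo --> (0 : R).
    by have := @cvg_harmonicM R y; rewrite -(cvg_shiftn 1); under eq_fun do rewrite addn1.
  have h1 : (f \o a) @ \oo --> f 0.
    apply: (within_cvg_seq cf) => //=; first by rewrite in_itv/= lexx ler01.
    by move=> n; rewrite in_itv/= (ltW (a0 n))/= (ltW (lt_trans (ay n) y1)).
  have h2 : (fun n => ip f1 (itv_ind (a n) y)) @ \oo --> ip f1 (itv_ind 0 y).
    apply: (@ip_itv_ind_cvg _ _ (fun=> y)) => // z; rewrite /= in_itv/= => /andP[z0 _].
    apply: cvg_near_cst; have := cvg_near_seq acvg z0.
    by apply: filterS => n az; rewrite !itv_indE az z0.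
  have h3 : (fun n => f y - ip f1 (itv_ind (a n) y)) @ \oo --> f y - ip f1 (itv_ind 0 y).
    by apply: cvgB => //; exact: cvg_cst.
  have E : f \o a = (fun n => f y - ip f1 (itv_ind (a n) y)).
    by apply/funext => n /=; rewrite -(H1_increment H)// subKr.
  rewrite -E in h3.
  have -> : f 0 = f y - ip f1 (itv_ind 0 y) by exact: (cvg_unique _ h1 h3).
  by rewrite subrK.
move: x0; rewrite le_eqVlt => /predU1P[<-|x0].
  have -> : ip f1 (itv_ind 0 0) = ip f1 (fun=> 0).
    by apply: eq_ip => // z _; rewrite itv_indE; case: ltP => //= z0; rewrite leNgt z0.
  by rewrite ip0r addr0.
move: x1; rewrite le_eqVlt => /predU1P[->|x1]; last exact: left.
pose b n : R := 1 - 2^-1 / n.+1%:R.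
have hn n : 0 < 2^-1 / n.+1%:R :> R by rewrite divr_gt0.
have hn2 n : 2^-1 / n.+1%:R <= 2^-1 :> R by rewrite ler_pdivrMr// ler_peMr// ler1n.
have bcvg : b @ \oo --> (1 : R).
  by rewrite -[X in _ --> X]subr0; apply: cvgB; [exact: cvg_cst|exact: cvg_harmonicM].
have h1 : (f \o b) @ \oo --> f 1.
  apply: (within_cvg_seq cf) => //=; first by rewrite in_itv/= lexx ler01.
  move=> n; rewrite in_itv/= /b; move: (hn n) (hn2 n).
  by move: (_ / _) => t t0 t2; apply/andP; split; lra.
have h2 : (fun n => ip f1 (itv_ind 0 (b n))) @ \oo --> ip f1 (itv_ind 0 1).
  apply: (@ip_itv_ind_cvg _ (fun=> 0)) => // z; rewrite /= in_itv/= => /andP[z0 z1].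
  apply: cvg_near_cst; have z10 : 0 < 1 - z by rewrite subr_gt0.
  have := cvg_near_seq (@cvg_harmonicM R 2^-1) z10.
  apply: filterS => n bz; rewrite !itv_indE z0/= (ltW z1) (_ : z <= b n)//.
  by rewrite /b lerBrDl -lerBrDr ltW.
have h3 : (fun n => f 0 + ip f1 (itv_ind 0 (b n))) @ \oo --> f 0 + ip f1 (itv_ind 0 1).
  by apply: cvgD => //; exact: cvg_cst.
have E : f \o b = (fun n => f 0 + ip f1 (itv_ind 0 (b n))).
  by apply/funext => n /=; rewrite -left// /b; move: (hn n) (hn2 n); move: (_ / _) => t; lra.
rewrite -E in h3; exact: (cvg_unique _ h1 h3).
Qed.

Lemma in_L2_restrict_integrable h : in_L2 Om h ->
  mu.-integrable setT (EFin \o (h \_ Om)).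
Proof.
move=> hL; have hi := in_L2M hL (@in_L2_cst R 1).
have -> : EFin \o (h \_ Om) = (EFin \o (fun x => h x * 1)) \_ Om.
  rewrite restrict_EFin; apply/funext => x /=; congr (_%:E).
  by rewrite !patchE mulr1.
by apply: (proj1 (integrable_mkcond _ _)) => //; exact: measurable_Om.
Qed.

(** Restriction replaces the domain of integration by the whole line, which is the
    form required by the theorem of Fubini. *)
Lemma EFin_ip h u : in_L2 Om h -> in_L2 Om u ->
  (ip h u)%:E = (\int[mu]_x ((h \_ Om) x * u x)%:E)%E.
Proof.
move=> hL uL; rewrite /ip /Rintegral fineK; last first.
  by apply: integrable_fin_num => //; exact: in_L2M.
rewrite integral_mkcond; apply: eq_integral => x _.
by rewrite !patchE; case: ifPn => //= _; rewrite mul0r.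
Qed.

Lemma restrict_ip_integrable h u : in_L2 Om h -> in_L2 Om u ->
  mu.-integrable setT (EFin \o (fun x => (h \_ Om) x * u x)).
Proof.
move=> hL uL.
have -> : EFin \o (fun x => (h \_ Om) x * u x) = (EFin \o (fun x => h x * u x)) \_ Om.
  apply/funext => x /=; rewrite !patchE; case: ifPn => //= _; by rewrite mul0r.
by apply: (proj1 (integrable_mkcond _ _)); [exact: measurable_Om|exact: in_L2M].
Qed.

(** Both sides are the integral of [f1 y * g1 x] over the triangle
    [0 < y <= x < 1]. *)
Lemma Fubini_triangle f1 g1 : in_L2 Om f1 -> in_L2 Om g1 ->
  \int[mu]_(x in Om) (g1 x * ip f1 (itv_ind 0 x)) =
  \int[mu]_(y in Om) (f1 y * ip g1 (\1_(`[y, +oo[%classic))).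
Proof.
move=> f1L g1L.
pose F := f1 \_ Om; pose G := g1 \_ Om.
have iF : mu.-integrable setT (EFin \o F) by exact: in_L2_restrict_integrable.
have iG : mu.-integrable setT (EFin \o G) by exact: in_L2_restrict_integrable.
pose k (z : measurableTypeR R * measurableTypeR R) : \bar R :=
  (G z.1 * F z.2 * (z.2 <= z.1)%R%:R)%:E.
have mF : measurable_fun setT F by apply/measurable_EFinP; exact: (measurable_int mu iF).
have mG : measurable_fun setT G by apply/measurable_EFinP; exact: (measurable_int mu iG).
have mk : measurable_fun setT k.
  apply/measurable_EFinP; apply: measurable_funM.
    apply: measurable_funM.
      exact: (measurableT_comp mG measurable_fst).
    exact: (measurableT_comp mF measurable_snd).
  rewrite (_ : (fun z => _) = \1_([set z : measurableTypeR R * measurableTypeR R | z.2 <= z.1])).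
    apply: measurable_indic; rewrite -[X in measurable X]setTI.
    by apply: measurable_fun_le.
  by apply/funext => z; rewrite indicE mem_setE.
have aF : mu.-integrable setT (fun y => `|(F y)%:E|)%E by exact: integrable_abse iF.
have aG : mu.-integrable setT (fun y => `|(G y)%:E|)%E by exact: integrable_abse iG.
have ik : (mu \x mu)%E.-integrable setT k.
  apply/(integrable12ltyP mu mu mk).
  have C : (\int[mu]_y `|(F y)%:E|)%E \is a fin_num by exact: integrable_fin_num.
  apply: (@le_lt_trans _ _ (\int[mu]_x (`|(G x)%:E| * \int[mu]_y `|(F y)%:E|))%E).
    apply: ge0_le_integral => //.
    - by move=> x _; apply: integral_ge0.
    - apply: (measurable_fun_fubini_tonelli_F (abse \o k)) => //; first exact: measurableT_comp.
      by move=> z; exact: abse_ge0.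
    - apply: emeasurable_funM; last exact: measurable_cst.
      exact: (measurable_int mu aG).
    - move=> x _; rewrite -ge0_integralZl//; last exact: (measurable_int mu aF).
      apply: ge0_le_integral => //.
      + apply: measurableT_comp => //.
        by apply: (measurableT_comp mk); exact: measurable_pair1.
      + by apply: measurable_funeM; exact: (measurable_int mu aF).
      + move=> y _; rewrite /k /= -EFinM lee_fin !normrM.
        by case: (y <= x); rewrite ?normr1 ?mulr1 ?normr0 ?mulr0 ?mulr_ge0.
  rewrite -(fineK C) ge0_integralZr//.
  - by rewrite lte_mul_pinfty ?integral_ge0// ?ltry// integrable_fin_num.
  - exact: (measurable_int mu aG).
  - by rewrite lee_fin fine_ge0 ?integral_ge0.
have inner x : (\int[mu]_y k (x, y))%E = (G x * ip f1 (itv_ind 0 x))%:E.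
  rewrite EFinM EFin_ip//; last exact: in_L2_itv_ind.
  rewrite -integralZl//; last by apply: restrict_ip_integrable => //; exact: in_L2_itv_ind.
  apply: eq_integral => y _; rewrite /k/= -EFinM -mulrA; congr (_ * _)%:E.
  rewrite /F itv_indE patchE; case: ifPn; rewrite ?mul0r// inE/= in_itv/= => /andP[y0 _].
  by rewrite y0.
have outer y : (\int[mu]_x k (x, y))%E = (F y * ip g1 (\1_(`[y, +oo[%classic)))%:E.
  have iL : in_L2 Om (\1_(`[y, +oo[%classic) : R -> R) by exact: in_L2_indic.
  rewrite EFinM EFin_ip// -integralZl//; last exact: restrict_ip_integrable.
  apply: eq_integral => x _; rewrite /k/= -EFinM; congr (_%:E).
  by rewrite indicE mem_setE in_itv/= andbT mulrA (mulrC (G x)).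
have := Fubini ik.
under eq_integral do rewrite inner.
under [RHS]eq_integral do rewrite outer.
move=> /(congr1 fine) E.
have restr h w : \int[mu]_(x in Om) (h x * w x) =
    fine (\int[mu]_x ((h \_ Om) x * w x)%:E)%E.
  rewrite Rintegral_mkcond; congr fine; apply: eq_integral => x _; congr EFin.
  by rewrite !patchE; case: (x \in Om); rewrite ?mul0r.
by rewrite (restr g1) (restr f1).
Qed.

(** With [f] and [g] written as primitives, the integrals of [g1 (f - f 0)] and of
    [f1 (g 1 - g)] are equal by [Fubini_triangle]. *)
Lemma abs_cont_parts f f1 g g1 : abs_cont f f1 -> abs_cont g g1 ->
  ip f1 g + ip f g1 = f 1 * g 1 - f 0 * g 0.
Proof.
move=> [fL f1L fE] [gL g1L gE].
have oL := @in_L2_cst R 1.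
have ip1 h1 : ip h1 (itv_ind 0 1) = ip h1 (fun=> 1).
  by apply: eq_ip => // x; rewrite /= in_itv/= => /andP[x0 x1]; rewrite itv_indE x0 ltW.
have f01 : ip f1 (fun=> 1) = f 1 - f 0.
  by rewrite -ip1 fE ?lexx ?ler01// addrC addKr.
have g01 : ip g1 (fun=> 1) = g 1 - g 0.
  by rewrite -ip1 gE ?lexx ?ler01// addrC addKr.
have := Fubini_triangle f1L g1L.
have -> : \int[mu]_(x in Om) (g1 x * ip f1 (itv_ind 0 x)) = ip g1 f - f 0 * (g 1 - g 0).
  rewrite -g01 -ipZr// -ipBr//; last exact: in_L2Z.
  apply: eq_Rintegral => x; rewrite inE/= in_itv/= => /andP[x0 x1].
  by rewrite [f x]fE ?ltW//= mulr1 addrC addKr.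
have -> : \int[mu]_(y in Om) (f1 y * ip g1 (\1_(`[y, +oo[%classic))) =
    g 1 * (f 1 - f 0) - ip f1 g.
  rewrite -f01 -ipZr// -ipBr//; last exact: in_L2Z.
  apply: eq_Rintegral => y; rewrite inE/= in_itv/= => /andP[y0 y1].
  congr (_ * _).
  have -> : ip g1 (\1_(`[y, +oo[%classic)) = ip g1 (itv_ind y 1).
    rewrite /ip; transitivity (\int[mu]_(x in `[y, 1[) g1 x).
      have -> : `[y, 1[%classic = Om `&` `[y, +oo[%classic.
        apply/seteqP; split => x /=; rewrite !in_itv/= ?andbT.
          by move=> /andP[yx x1]; rewrite x1 yx (lt_le_trans y0 yx).
        by move=> [/andP[_ ->] ->].
      rewrite Rintegral_mkcondr; apply: eq_Rintegral => x _.
      by rewrite patchE indicE; case: ifPn; rewrite ?mulr1 ?mulr0.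
    rewrite -Rintegral_itv_obnd_cbnd; last first.
      have -> : EFin \o g1 = EFin \o (fun x => g1 x * 1).
        by apply/funext => x /=; rewrite mulr1.
      by apply: integrableS (in_L2M g1L oL) => //; apply: subset_itvr; rewrite bnd_simp ltW.
    have -> : `]y, 1[%classic = Om `&` `]y, 1]%classic.
      apply/seteqP; split => x /=; rewrite !in_itv/= ?andbT.
        by move=> /andP[yx x1]; rewrite x1 yx (lt_trans y0 yx) ltW.
      by move=> [/andP[_ ->] /andP[-> _]].
    rewrite Rintegral_mkcondr; apply: eq_Rintegral => x _.
    by rewrite /itv_ind patchE indicE; case: ifPn; rewrite ?mulr1 ?mulr0.
  rewrite [g y]gE ?ltW// mulr1 gE ?lexx ?ler01//.
  have -> : ip g1 (itv_ind 0 1) = ip g1 (itv_ind 0 y) + ip g1 (itv_ind y 1).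
    rewrite (ipC _ (itv_ind 0 y)) (ipC _ (itv_ind y 1)) -ipDl//; try exact: in_L2_itv_ind.
    rewrite ipC; apply: eq_ip => // x; rewrite /= in_itv/= => /andP[x0 x1].
    rewrite !itv_indE x0 (ltW x1) !andbT /=.
    by case: leP => xy; rewrite ?mulr1n ?mulr0n ?addr0 ?add0r.
  ring.
rewrite (ipC g1 f) => h; lra.
Qed.
End abs_cont.

(** * Energy identity for pairs of waves *)

Section energy.
Context {R : realType}.
Local Notation mu := (@lebesgue_measure R).
Local Notation Om := (`]0, 1[%classic : set R).
Implicit Types (f g F : R -> R).

Lemma abs_cont_C1 f f1 : (forall x : R, is_derive x 1 f (f1 x)) -> continuous f1 -> abs_cont f f1.
Proof.
move=> df cf1; split.
- by apply: in_L2_continuous => x; exact: is_derive_cts (df x).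
- exact: in_L2_continuous.
move=> x /andP[x0 x1].
have {x0}[x0|x0] : x = 0 \/ 0 < x by move: x0; rewrite le_eqVlt => /predU1P[->|]; [left|right].
  have -> : ip f1 (itv_ind 0 x) = ip f1 (fun=> 0).
    by apply: eq_ip => // z _; rewrite itv_indE x0; case: ltP => //= z0; rewrite leNgt z0.
  by rewrite ip0r addr0 x0.
suff -> : ip f1 (itv_ind 0 x) = \int[mu]_(z in `]0, x[) f1 z.
  by rewrite (Rintegral_itvoo_derive x0 df cf1) addrC subrK.
transitivity (\int[mu]_(z in Om `&` `]0, x]) f1 z).
  rewrite Rintegral_mkcondr; apply: eq_Rintegral => z _.
  by rewrite /itv_ind patchE indicE; case: ifPn; rewrite ?mulr1 ?mulr0.
move: x1; rewrite le_eqVlt => /predU1P[->|x1].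
  congr (Rintegral _ _ _); apply/seteqP; split => z /=; rewrite !in_itv/=; first by case.
  by move=> /[dup] /andP[-> z1] ->; rewrite ltW.
have -> : Om `&` `]0, x]%classic = `]0, x]%classic.
  apply/seteqP; split => z /=; rewrite !in_itv/=; first by case.
  by move=> /andP[z0 zx]; rewrite z0 zx (le_lt_trans zx).
rewrite -Rintegral_itv_bndo_bndc//.
by apply: integrable_within_itvoo; exact: continuous_subspaceT.
Qed.

Lemma abs_cont_B f f1 g g1 : abs_cont f f1 -> abs_cont g g1 ->
  abs_cont (fun x => f x - g x) (fun x => f1 x - g1 x).
Proof.
move=> [fL f1L fE] [gL g1L gE]; split; [exact: in_L2B..|].
move=> x x01; rewrite fE// gE// ipBl//; last exact: in_L2_itv_ind.
by rewrite opprD addrACA.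
Qed.

(** Integration by parts against [1 - x] turns the value at [0] into a functional
    that is continuous for the [H^1] norm; it yields the continuity in time of
    traces in [abs_cont_trace_cvg]. *)
Lemma abs_cont_trace f f1 : abs_cont f f1 ->
  f 0 = ip f (fun=> 1) - ip f1 (fun x => 1 - x).
Proof.
move=> fA; have [fL f1L _] := fA; have oL := @in_L2_cst R 1.
have gA : abs_cont (fun x : R => 1 - x) (fun=> -1).
  apply: abs_cont_C1; last by move=> x; exact: cvg_cst.
  by move=> x; rewrite -[X in is_derive _ _ _ X]add0r; apply: is_deriveB.
have := abs_cont_parts fA gA; rewrite ipNr//; lra.
Qed.

Lemma abs_cont_sup f f1 x : abs_cont f f1 -> f 1 = 0 -> 0 <= x <= 1 -> `|f x| <= nrm f1.
Proof.
move=> [fL f1L fE] f10 x01.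
have L0 := @in_L2_itv_ind R 0 x; have L1 := @in_L2_itv_ind R 0 1.
have -> : f x = ip f1 (fun z => itv_ind 0 x z - itv_ind 0 1 z).
  rewrite ipBr// fE//; have := fE 1; rewrite lexx ler01 f10 => /(_ isT); lra.
apply: le_trans (ler_normip _ _) _ => //; first exact: in_L2B.
rewrite ler_piMr ?nrm_ge0//; apply: nrm_le => //; first exact: in_L2B.
move=> z; rewrite /= in_itv/= => /andP[z0 z1]; rewrite !itv_indE z0 (ltW z1)/=.
by case: (z <= x); rewrite /= ?mulr1n ?mulr0n ?subrr ?sub0r ?normrN ?normr1 ?normr0.
Qed.

Lemma abs_cont_poincare f f1 : abs_cont f f1 -> f 1 = 0 -> nrm f <= nrm f1.
Proof.
move=> fA f10; have [fL _ _] := fA; apply: nrm_le; rewrite ?nrm_ge0// => x.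
by rewrite /= in_itv/= => /andP[x0 x1]; apply: abs_cont_sup => //; rewrite !ltW.
Qed.

Lemma ip_cvgl (T : Type) (Fl : set_system T) (FF : Filter Fl) (F : T -> R -> R) f g :
  (\forall s \near Fl, in_L2 Om (F s)) -> in_L2 Om f -> in_L2 Om g ->
  (fun s => nrm (fun x => F s x - f x)) @ Fl --> (0 : R) ->
  (fun s => ip (F s) g) @ Fl --> ip f g.
Proof.
move=> FL fL gL Ff; apply: ip_cvg => //; first exact: nearW.
rewrite (_ : (fun n => _) = (fun=> 0)); first exact: cvg_cst.
by apply/funext => n; rewrite /nrm ipBl ?subrr ?sqrtr0//; exact: in_L2B.
Qed.

Lemma abs_cont_trace_cvg (T : Type) (Fl : set_system T) (FF : Filter Fl)
   (F F1 : T -> R -> R) f f1 :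
  (\forall s \near Fl, abs_cont (F s) (F1 s)) -> abs_cont f f1 ->
  (fun s => nrm (fun x => F s x - f x)) @ Fl --> (0 : R) ->
  (fun s => nrm (fun x => F1 s x - f1 x)) @ Fl --> (0 : R) ->
  (fun s => F s 0) @ Fl --> f 0.
Proof.
move=> FA fA cF cF1; have [fL f1L _] := fA.
have L1 := @in_L2_cst R 1.
have Lx : in_L2 Om (fun x : R => 1 - x).
  by apply: in_L2_continuous => x; apply: cvgB; [exact: cvg_cst|exact: cvg_id].
have E : \forall s \near Fl, ip (F s) (fun=> 1) - ip (F1 s) (fun x => 1 - x) = F s 0.
  by near=> s; rewrite -abs_cont_trace//; near: s.
rewrite (abs_cont_trace fA); apply: cvg_trans (near_eq_cvg E) _.
by apply: cvgB; apply: ip_cvgl => //; apply: filterS FA => s [].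
Unshelve. all: by end_near. Qed.

(** Near time [t] the pair [(U, V)] is a trajectory of [U_t = V, V_t = U_xx] with
    [U = 0] at [x = 1]; [g] stands for [U_t(t, 0)].  It gathers what the solution on
    a forward interval, the solution on a backward interval read backwards in time,
    and the explicit test waves have in common. *)
Record wave_at (U Ux Uxx V : R -> R -> R) (g t : R) : Prop := WaveAt {
  wa_near : \forall s \near t,
    [/\ abs_cont (U s) (Ux s), abs_cont (Ux s) (Uxx s), in_L2 Om (V s) & U s 1 = 0] ;
  wa_Ux : (fun s => nrm (fun x => Ux s x - Ux t x)) @ t^' --> (0 : R) ;
  wa_Uxx : (fun s => nrm (fun x => Uxx s x - Uxx t x)) @ t^' --> (0 : R) ;
  wa_V : (fun s => nrm (fun x => V s x - V t x)) @ t^' --> (0 : R) ;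
  wa_dU : (fun s => nrm (fun x => (s - t)^-1 * (U s x - U t x) - V t x)) @ t^' --> (0 : R) ;
  wa_dV : (fun s => nrm (fun x => (s - t)^-1 * (V s x - V t x) - Uxx t x)) @ t^' --> (0 : R) ;
  wa_bd : is_derive t 1 (fun s => U s 0) g
}.

(** The polar form of (twice) the wave energy, for two trajectories. *)
Definition wave_energy (Ux V Ux' V' : R -> R -> R) (s : R) : R :=
  ip (Ux s) (Ux' s) + ip (V s) (V' s).

(** For smooth waves the derivative is [[V Ux' + V' Ux]] between the end points.
    Since [Ux] is merely continuous in time, the increment of [ip Ux Ux'] is first
    split as a product and integrated by parts in [x]; the quotients that remain are
    those of [U] and [V]. *)
Lemma wave_energy_derive (U Ux Uxx V : R -> R -> R) (g : R)
    (U' Ux' Uxx' V' : R -> R -> R) (g' t : R) :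
  wave_at U Ux Uxx V g t -> wave_at U' Ux' Uxx' V' g' t ->
  is_derive t 1 (wave_energy Ux V Ux' V') (- (g * Ux' t 0 + g' * Ux t 0)).
Proof.
move=> H H'; apply/is_derive_quot.
have [A0 Ax0 V0 U10] := nbhs_singleton (wa_near H).
have [A0' Ax0' V0' U10'] := nbhs_singleton (wa_near H').
have [U0L Ux0L _] := A0; have [U0L' Ux0L' _] := A0'.
have [_ Uxx0L _] := Ax0; have [_ Uxx0L' _] := Ax0'.
have Nd : \forall s \near t^', [/\ abs_cont (U s) (Ux s), abs_cont (Ux s) (Uxx s), in_L2 Om (V s) & U s 1 = 0].
  exact: nbhs_dnbhs (wa_near H).
have Nd' : \forall s \near t^', [/\ abs_cont (U' s) (Ux' s), abs_cont (Ux' s) (Uxx' s), in_L2 Om (V' s) & U' s 1 = 0].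
  exact: nbhs_dnbhs (wa_near H').
pose Q (F : R -> R -> R) s x := (s - t)^-1 * (F s x - F t x).
pose q (F : R -> R -> R) s := (s - t)^-1 * (F s 0 - F t 0).
(* the difference quotient of the energy after integration by parts in [x] *)
pose B s := (- (q U s * Ux' s 0) - ip (Q U s) (Uxx' s))
  + (- (q U' s * Ux t 0) - ip (Q U' s) (Uxx t))
  + ip (Q V s) (V' s) + ip (Q V' s) (V t).
have BE : \forall s \near t^', B s =
    (s - t)^-1 * (wave_energy Ux V Ux' V' s - wave_energy Ux V Ux' V' t).
  near=> s.
  have [As Axs Vs U1s] : [/\ abs_cont (U s) (Ux s), abs_cont (Ux s) (Uxx s), in_L2 Om (V s) & U s 1 = 0].
    by near: s.
  have [As' Axs' Vs' U1s'] : [/\ abs_cont (U' s) (Ux' s), abs_cont (Ux' s) (Uxx' s), in_L2 Om (V' s) & U' s 1 = 0].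
    by near: s.
  have [UL UxL _] := As; have [UL' UxL' _] := As'.
  have [_ UxxL _] := Axs; have [_ UxxL' _] := Axs'.
  have P1 := abs_cont_parts (abs_cont_B As A0) Axs'.
  have P2 := abs_cont_parts (abs_cont_B As' A0') Ax0.
  rewrite /B /Q /q /wave_energy !ipZl//; try exact: in_L2B.
  move: P1 P2; rewrite !U1s !U1s' !U10 !U10' !ipBl//.
  rewrite (ipC (Ux' s) (Ux t)) (ipC (Ux' t) (Ux t)) (ipC (V' s) (V t)) (ipC (V' t) (V t)).
  rewrite subrr mul0r !sub0r => P1 P2.
  transitivity ((s - t)^-1 * (- ((U s 0 - U t 0) * Ux' s 0) - (ip (U s) (Uxx' s) - ip (U t) (Uxx' s))
   - (U' s 0 - U' t 0) * Ux t 0 - (ip (U' s) (Uxx t) - ip (U' t) (Uxx t))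
   + (ip (V s) (V' s) - ip (V t) (V' s)) + (ip (V t) (V' s) - ip (V t) (V' t)))); first by ring.
  by congr (_ * _); lra.
apply: cvg_trans (near_eq_cvg BE) _.
have -> : - (g * Ux' t 0 + g' * Ux t 0) =
  (- (g * Ux' t 0) - ip (V t) (Uxx' t)) + (- (g' * Ux t 0) - ip (V' t) (Uxx t))
  + ip (Uxx t) (V' t) + ip (Uxx' t) (V t).
  by rewrite (ipC (Uxx t)) (ipC (Uxx' t)); ring.
have qU : q U @ t^' --> g by apply/is_derive_quot; exact: wa_bd H.
have qU' : q U' @ t^' --> g' by apply/is_derive_quot; exact: wa_bd H'.
have QL (F : R -> R -> R) : in_L2 Om (F t) -> (\forall s \near t^', in_L2 Om (F s)) ->
    \forall s \near t^', in_L2 Om (Q F s).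
  by move=> F0; apply: filterS => s Fs; apply/in_L2Z/in_L2B.
apply: cvgD; [apply: cvgD; [apply: cvgD; apply: cvgB|]|].
- apply: cvgN; apply: cvgM => //.
  apply: abs_cont_trace_cvg (wa_Ux H') (wa_Uxx H') => //.
  by apply: filterS Nd' => s [].
- apply: ip_cvg (wa_dU H) (wa_Uxx H') => //.
    by apply: QL => //; apply: filterS Nd => s [[]].
  by apply: filterS Nd' => s [_ []].
- by apply: cvgN; apply: cvgM => //; exact: cvg_cst.
- apply: ip_cvgl (wa_dU H') => //.
  by apply: QL => //; apply: filterS Nd' => s [[]].
- apply: ip_cvg (wa_dV H) (wa_V H') => //.
    by apply: QL => //; apply: filterS Nd => s [].
  by apply: filterS Nd' => s [].
- apply: ip_cvgl (wa_dV H') => //.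
  by apply: QL => //; apply: filterS Nd' => s [].
Unshelve. all: by end_near. Qed.
End energy.

(** * Uniform continuity of translations *)

Section uniform.
Context {R : realType}.
Local Notation Om := (`]0, 1[%classic : set R).
Implicit Types (h : R -> R).

Lemma nrm_unif_cvg0 (T : Type) (Fl : set_system T) (FF : Filter Fl) (G : T -> R -> R) :
  (\forall s \near Fl, in_L2 Om (G s)) ->
  (forall e, 0 < e -> \forall s \near Fl, forall x, Om x -> `|G s x| <= e) ->
  (fun s => nrm (G s)) @ Fl --> (0 : R).
Proof.
move=> GL Ge; apply/cvgrPdist_le => e e0; near=> s.
rewrite sub0r normrN ger0_norm ?nrm_ge0//; apply: nrm_le; first exact: ltW.
  by near: s.
by near: s; exact: Ge.
Unshelve. all: by end_near. Qed.

(** A uniform continuity statement, obtained from the compactness of [[0, 2]].  The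
    points [x] and [2 - x] used by the test waves lie in that segment. *)
Lemma shift_unif_cts h (t e : R) : continuous h -> 0 < e ->
  \forall s \near t, forall y, 0 <= y <= 2 -> `|h (s + y) - h (t + y)| <= e.
Proof.
move=> ch e0.
have cpt : compact (`[0, 2]%classic : set R) by exact: segment_compact.
have K : \forall s \near t, `[0, 2]%classic `<=` (fun y : R => `|h (s + y) - h (t + y)| <= e).
  move/compact_near_coveringP : cpt => /(_ R (nbhs t) (fun s y => `|h (s + y) - h (t + y)| <= e)).
  apply => y _.
  have e2 : 0 < e / 2 by rewrite divr_gt0.
  have /cvgrPdist_lt/(_ _ e2)[d /= d0 Hd] := ch (t + y).
  have d2 : 0 < d / 2 by rewrite divr_gt0.
  exists (ball y (d / 2), ball t (d / 2)).
    by split; [exact: nbhsx_ballx|exact: nbhsx_ballx].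
  move=> [y' s] [/= yy' ts].
  have h1 : `|h (t + y) - h (s + y')| < e / 2.
    apply: Hd => /=; rewrite (_ : _ - _ = (t - s) + (y - y')); last by ring.
    by rewrite (le_lt_trans (ler_normD _ _))// [ltRHS]splitr ltrD.
  have h2 : `|h (t + y) - h (t + y')| < e / 2.
    apply: Hd => /=; rewrite (_ : _ - _ = y - y'); last by ring.
    by rewrite (lt_trans yy')// gtr_pMr// invf_lt1 ?ltr1n.
  rewrite (_ : _ - _ = (h (t + y) - h (t + y')) - (h (t + y) - h (s + y'))); last by ring.
  rewrite (le_trans (ler_normB _ _))// [leRHS]splitr lerD ?ltW//.
by apply: filterS K => s Hs y y02; apply: Hs; rewrite /= in_itv.
Qed.

Lemma quot_unif_cts h (h1 : R -> R) (t e : R) : (forall r : R, is_derive r 1 h (h1 r)) ->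
  continuous h1 -> 0 < e ->
  \forall s \near t^', forall y, 0 <= y <= 2 ->
    `|(s - t)^-1 * (h (s + y) - h (t + y)) - h1 (t + y)| <= e.
Proof.
move=> dh ch1 e0.
have [d /= d0 Hd] := shift_unif_cts t ch1 e0.
have ch : continuous h by move=> x; exact: is_derive_cts (dh x).
exists d => // s /=; rewrite distrC => sd st y y02.
have mvt a b : a < b -> exists2 c, a < c < b & h b - h a = h1 c * (b - a).
  move=> ab; have [|c cab E] := @MVT R h h1 a b ab (fun x _ => dh x).
    exact: continuous_subspaceT.
  by exists c => //; move: cab; rewrite in_itv.
have fin c : `|c - t| < d -> h (s + y) - h (t + y) = h1 (c + y) * (s - t) ->
    `|(s - t)^-1 * (h (s + y) - h (t + y)) - h1 (t + y)| <= e.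
  move=> cd ->; rewrite mulrCA mulVf ?subr_eq0// mulr1.
  by apply: Hd => //=; rewrite distrC.
move: sd; rewrite ltr_norml => /andP[sd1 sd2].
have [lts|gts|E] := ltgtP s t; last by rewrite E eqxx in st.
  have [|c /andP[c1 c2] E] := mvt (s + y) (t + y); first by rewrite ltrD2r.
  apply: (fin (c - y)); first by rewrite ltr_norml; apply/andP; split; lra.
  by rewrite subrK; move: E; lra.
have [|c /andP[c1 c2] E] := mvt (t + y) (s + y); first by rewrite ltrD2r.
apply: (fin (c - y)); first by rewrite ltr_norml; apply/andP; split; lra.
by rewrite subrK; move: E; lra.
Qed.
End uniform.

(** * Explicit waves reflected at x = 1 *)

Section testwave.
Context {R : realType}.
Local Notation Om := (`]0, 1[%classic : set R).
Implicit Types (h : R -> R) (s t x : R).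
Variables (P p p1 : R -> R).
Hypothesis dP : forall r : R, is_derive r 1 P (p r).
Hypothesis dp : forall r : R, is_derive r 1 p (p1 r).
Hypothesis cp1 : continuous p1.

(** The difference is d'Alembert's formula for a wave that vanishes at [x = 1]; the
    sum appears in its derivatives. *)
Definition refl_minus (h : R -> R) (s x : R) : R := h (s + x) - h (s + (2 - x)).
Definition refl_plus (h : R -> R) (s x : R) : R := h (s + x) + h (s + (2 - x)).

Lemma is_derive_shiftl h (h1 : R -> R) (s x : R) : (forall r : R, is_derive r 1 h (h1 r)) ->
  is_derive x 1 (fun x => h (s + x)) (h1 (s + x)).
Proof.
move=> dh; have := @is_derive_affine _ h 1 s x _ (dh (1 * x + s)).
rewrite !mul1r addrC; congr (is_derive _ _ _ _).
by apply/funext => z; rewrite mul1r addrC.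
Qed.

Lemma is_derive_refl h (h1 : R -> R) (s x : R) : (forall r : R, is_derive r 1 h (h1 r)) ->
  is_derive x 1 (fun x => h (s + (2 - x))) (- h1 (s + (2 - x))).
Proof.
move=> dh; have := @is_derive_affine _ h (-1) (s + 2) x _ (dh _).
rewrite !mulN1r (_ : - x + (s + 2) = s + (2 - x)); last by ring.
congr (is_derive _ _ _ _).
by apply/funext => z; congr h; ring.
Qed.

Lemma is_derive_refl_minus h (h1 : R -> R) (s x : R) : (forall r : R, is_derive r 1 h (h1 r)) ->
  is_derive x 1 (refl_minus h s) (refl_plus h1 s x).
Proof.
move=> dh; rewrite /refl_plus -[h1 (s + (2 - x))]opprK.
by apply: is_deriveB; [exact: is_derive_shiftl|exact: is_derive_refl].
Qed.

Lemma is_derive_refl_plus h (h1 : R -> R) (s x : R) : (forall r : R, is_derive r 1 h (h1 r)) ->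
  is_derive x 1 (refl_plus h s) (refl_minus h1 s x).
Proof.
move=> dh; rewrite /refl_minus.
by apply: is_deriveD; [exact: is_derive_shiftl|exact: is_derive_refl].
Qed.

Lemma continuous_refl h s : continuous h ->
  continuous (refl_minus h s) /\ continuous (refl_plus h s).
Proof.
move=> ch.
have c1 : continuous (fun x => h (s + x)).
  move=> x; apply: (@cvg_comp _ _ _ (fun x => s + x) h); last exact: ch.
  by apply: cvgD; [exact: cvg_cst|exact: cvg_id].
have c2 : continuous (fun x => h (s + (2 - x))).
  move=> x; apply: (@cvg_comp _ _ _ (fun x => s + (2 - x)) h); last exact: ch.
  by apply: cvgD; [exact: cvg_cst|apply: cvgB; [exact: cvg_cst|exact: cvg_id]].
by split => x; [apply: cvgB|apply: cvgD]; [exact: c1|exact: c2|exact: c1|exact: c2].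
Qed.

Let cp : continuous p.
Proof. by move=> x; exact: is_derive_cts (dp x). Qed.

Lemma refl_unif h t : continuous h ->
  (fun s => nrm (fun x => refl_minus h s x - refl_minus h t x)) @ t --> (0 : R) /\
  (fun s => nrm (fun x => refl_plus h s x - refl_plus h t x)) @ t --> (0 : R).
Proof.
move=> ch; have cL s := continuous_refl s ch.
split; apply: nrm_unif_cvg0.
- by apply: nearW => s; apply: in_L2B; apply: in_L2_continuous; apply: (cL _).1.
- move=> e e0; have e2 : 0 < e / 2 by rewrite divr_gt0.
  have := shift_unif_cts t ch e2; apply: filterS => s H x.
  rewrite /= in_itv/= => /andP[x0 x1]; rewrite /refl_minus.
  rewrite (_ : _ - _ = (h (s + x) - h (t + x)) - (h (s + (2 - x)) - h (t + (2 - x)))); last by ring.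
  by rewrite (le_trans (ler_normB _ _))// [leRHS]splitr lerD// H//; lra.
- by apply: nearW => s; apply: in_L2B; apply: in_L2_continuous; apply: (cL _).2.
- move=> e e0; have e2 : 0 < e / 2 by rewrite divr_gt0.
  have := shift_unif_cts t ch e2; apply: filterS => s H x.
  rewrite /= in_itv/= => /andP[x0 x1]; rewrite /refl_plus.
  rewrite (_ : _ - _ = (h (s + x) - h (t + x)) + (h (s + (2 - x)) - h (t + (2 - x)))); last by ring.
  by rewrite (le_trans (ler_normD _ _))// [leRHS]splitr lerD// H//; lra.
Qed.

Lemma refl_quot h (h1 : R -> R) t : (forall r : R, is_derive r 1 h (h1 r)) -> continuous h1 ->
  (fun s => nrm (fun x => (s - t)^-1 * (refl_minus h s x - refl_minus h t x) - refl_minus h1 t x))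
    @ t^' --> (0 : R).
Proof.
move=> dh ch1.
have ch : continuous h by move=> x; exact: is_derive_cts (dh x).
have cL s := (continuous_refl s ch).1.
apply: nrm_unif_cvg0.
- apply: nearW => s; apply: in_L2B; [apply/in_L2Z/in_L2B|]; apply: in_L2_continuous => //.
  exact: (continuous_refl t ch1).1.
- move=> e e0; have e2 : 0 < e / 2 by rewrite divr_gt0.
  have := quot_unif_cts t dh ch1 e2; apply: filterS => s H x.
  rewrite /= in_itv/= => /andP[x0 x1]; rewrite /refl_minus.
  rewrite (_ : _ - _ = ((s - t)^-1 * (h (s + x) - h (t + x)) - h1 (t + x)) -
     ((s - t)^-1 * (h (s + (2 - x)) - h (t + (2 - x))) - h1 (t + (2 - x)))); last by ring.
  by rewrite (le_trans (ler_normB _ _))// [leRHS]splitr lerD// H//; lra.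
Qed.

Lemma test_wave_at (t : R) :
  wave_at (refl_minus P) (refl_plus p) (refl_minus p1) (refl_minus p) (p t - p (t + 2)) t.
Proof.
split.
- apply: filterE => s; split.
  + by apply: abs_cont_C1; [move=> x; exact: is_derive_refl_minus|exact: (continuous_refl s cp).2].
  + by apply: abs_cont_C1; [move=> x; exact: is_derive_refl_plus|exact: (continuous_refl s cp1).1].
  + exact: in_L2_continuous (continuous_refl s cp).1.
  + by rewrite /refl_minus (_ : 2 - 1 = 1 :> R) ?subrr//; lra.
- exact: cvg_within_filter (refl_unif t cp).2.
- exact: cvg_within_filter (refl_unif t cp1).1.
- exact: cvg_within_filter (refl_unif t cp).1.
- exact: refl_quot.
- exact: refl_quot.
- rewrite /refl_minus.
  have := is_deriveB (is_derive_shiftl 0 t dP) (is_derive_shiftl 2 t dP).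
  rewrite add0r (addrC 2); congr (is_derive _ _ _ _).
  by apply/funext => z; rewrite /= fctE; congr (P _ - P _); ring.
Qed.
End testwave.

(** * Profiles of test waves *)

Section profiles.
Context {R : realType}.
Local Notation mu := (@lebesgue_measure R).
Local Notation Om := (`]0, 1[%classic : set R).
Implicit Types (f h : R -> R) (r : R).

Lemma near_lt_cst (x a : R) : x < a -> \forall y \near x, y < a.
Proof. by move=> xa; exact: lt_nbhsl. Qed.

(** Vanishing on the left allows the primitive to be an integral from a fixed
    origin, with a derivative at every point of the line. *)
Lemma primitive_exists f (a : R) : continuous f -> (forall r, r <= a -> f r = 0) ->
  exists F, forall r : R, is_derive r 1 F (f r).
Proof.
move=> cf f0.
pose F x := \int[mu]_(t in [set` `[a - 1, x]]) f t.
exists F => r.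
have [ra|ar] := ltP r a.
  have F0 x : x < a -> F x = 0.
    move=> xa; rewrite /F -[RHS](mul0r (fine (mu `[a - 1, x]%classic))) -Rintegral_cst//.
    apply: eq_Rintegral => t; rewrite inE/= in_itv/= => /andP[_ tx].
    by rewrite f0// (le_trans tx)// ltW.
  rewrite f0 ?ltW//; apply: (@near_eq_is_derive _ _ _ (fun=> 0) F) => //.
  by apply: filterS (near_lt_cst ra) => x /F0.
have ar1 : a - 1 < r by lra.
have [dF F'] := @continuous_FTC1_closed R f (a - 1) r (r + 1) ltac:(lra)
  (continuous_compact_integrable (@segment_compact _ _ _) (continuous_subspaceT cf)) ar1 (cf r).
by apply: (DeriveDef dF); rewrite -derive1E.
Qed.

Lemma derive_mvt f (f1 : R -> R) (a b : R) : (forall r : R, is_derive r 1 f (f1 r)) ->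
  a < b -> exists2 c, a < c < b & f b - f a = f1 c * (b - a).
Proof.
move=> df ab; have [|c cab E] := @MVT R f f1 a b ab (fun x _ => df x).
  by apply: continuous_subspaceT => x; exact: is_derive_cts (df x).
by exists c => //; move: cab; rewrite in_itv.
Qed.

(** Averaging gains one derivative, and an average over [[r, r + d]] is a value of
    [f] in that window: pointwise properties of [f] pass to [p]. *)
Lemma moving_average f (a d : R) : continuous f -> 0 < d -> (forall r, r <= a -> f r = 0) ->
  exists P p p1 : R -> R, [/\ forall r : R, is_derive r 1 P (p r),
    forall r : R, is_derive r 1 p (p1 r), continuous p1 &
    forall r, exists2 x, r < x < r + d & p r = f x].
Proof.
move=> cf d0 f0.
have [F dF] := primitive_exists cf f0.
pose p r := d^-1 * (F (d + r) - F (0 + r)).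
pose p1 r := d^-1 * (f (d + r) - f (0 + r)).
have pE r : exists2 x, r < x < r + d & p r = f x.
  have [|c cr E] := @derive_mvt F f r (r + d) dF; first by rewrite ltrDl.
  exists c => //; rewrite /p add0r (addrC d) E addrAC subrr add0r mulrCA mulVf ?mulr1//.
  exact: lt0r_neq0.
have dp r : is_derive r 1 p (p1 r).
  have H := is_deriveB (is_derive_shiftl d r dF) (is_derive_shiftl 0 r dF).
  exact: (@is_deriveZ _ _ _ _ (d^-1) _ _ _ H).
have cp1 : continuous p1.
  move=> r; apply: cvgM; first exact: cvg_cst.
  apply: cvgB.
    apply: (@cvg_comp _ _ _ (fun x => d + x) f); last exact: cf.
    by apply: cvgD; [exact: cvg_cst|exact: cvg_id].
  apply: (@cvg_comp _ _ _ (fun x => 0 + x) f); last exact: cf.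
  by apply: cvgD; [exact: cvg_cst|exact: cvg_id].
have cp : continuous p by move=> r; exact: is_derive_cts (dp r).
have [|P dP] := @primitive_exists p (a - d) cp.
  by move=> r ra; have [x /andP[_ xr] ->] := pE r; rewrite f0//; lra.
by exists P, p, p1.
Qed.

Definition clamp01 (u : R) : R := Num.max 0 (Num.min u 1).

Lemma continuous_clamp01 f : continuous f -> continuous (fun x => clamp01 (f x)).
Proof.
move=> cf x; apply: (@continuous_max _ _ (fun=> 0) (fun x => Num.min (f x) 1)); first exact: cvg_cst.
by apply: (@continuous_min _ _ f (fun=> 1)); [exact: cf|exact: cvg_cst].
Qed.

Lemma clamp01_le0 u : u <= 0 -> clamp01 u = 0.
Proof. by move=> u0; rewrite /clamp01 max_l// min_l//; lra. Qed.

Lemma clamp01_ge1 u : 1 <= u -> clamp01 u = 1.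
Proof. by move=> u1; rewrite /clamp01 min_r// max_r. Qed.

Lemma clamp01_itv u : 0 <= clamp01 u <= 1.
Proof. by rewrite /clamp01 le_max lexx/= ge_max ler01/= ge_min lexx orbT. Qed.

Lemma clamp01_id u : 0 <= u <= 1 -> clamp01 u = u.
Proof. by move=> /andP[u0 u1]; rewrite /clamp01 min_l// max_r. Qed.

Lemma continuous_affine (a b : R) : continuous (fun x : R => a + b * x).
Proof.
move=> x; apply: cvgD; first exact: cvg_cst.
by apply: cvgM; [exact: cvg_cst|exact: cvg_id].
Qed.

Lemma continuous_reflected (b : R -> R) : {within `[0, 1], continuous b} ->
  continuous (fun r => b (clamp01 (Num.min r (2 - r)))).
Proof.
move=> /subspace_continuousP cb r.
have k01 x : clamp01 x \in `[0, 1] by rewrite in_itv/= clamp01_itv.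
have kc : continuous (fun r => clamp01 (Num.min r (2 - r))).
  apply: continuous_clamp01 => x; apply: (@continuous_min _ _ id (fun r => 2 - r)); first exact: cvg_id.
  by apply: cvgB; [exact: cvg_cst|exact: cvg_id].
apply: cvg_trans (cb _ (k01 _)) => A /= HA.
have K : \forall x \near r, `[0, 1]%classic (clamp01 (Num.min x (2 - x))) ->
    A (b (clamp01 (Num.min x (2 - x)))) by exact: kc r _ HA.
by apply: filterS K => x Hx; apply: Hx; exact: k01.
Qed.

(** The initial data of a test wave can be brought as close as desired, in [L^2], to
    [(b, 0)], while its profile takes the value [c] at [0] and vanishes beyond [2].
    The ideal profile is half of [b] on [[0, 1]], reflected at [1]; it is cut off at
    both ends on a scale [1 / (n+1)], set to [c] near [0], and averaged. *)
Lemma test_family (b : R -> R) (c eps : R) : {within `[0, 1], continuous b} -> 0 < eps ->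
  exists P p p1 : R -> R, [/\ forall r : R, is_derive r 1 P (p r),
    forall r : R, is_derive r 1 p (p1 r), continuous p1,
    p 0 = c /\ (forall r, 2 <= r -> p r = 0) &
    nrm (fun x => refl_plus p 0 x - b x) <= eps /\ nrm (refl_minus p 0) <= eps].
Proof.
move=> cb eps0.
have [M [_ bM]] := compact_bounded (continuous_compact cb (@segment_compact _ 0 1)).
pose M1 := `|M| + 1.
have bb x : 0 <= x <= 1 -> `|b x| <= M1.
  move=> x01; apply: (bM M1); first by rewrite /M1 ltr_pwDr// ler_norm.
  by exists x => //; rewrite /= in_itv.
have M10 : 0 <= M1 by rewrite /M1 addr_ge0.
pose B r := 2^-1 * b (clamp01 (Num.min r (2 - r))).
have cB : continuous B.
  by move=> r; apply: cvgM; [exact: cvg_cst|exact: continuous_reflected].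
have BM r : `|B r| <= M1.
  rewrite normrM gtr0_norm ?invr_gt0//; have := bb _ (clamp01_itv (Num.min r (2 - r))); lra.
pose N (n : nat) : R := n.+1%:R.
have N0 n : 0 < N n by rewrite ltr0n.
have N1 n : 1 <= N n by rewrite ler1n.
have Ninv : (fun n => (N n)^-1) @ \oo --> (0 : R) by exact: cvg_harmonic.
clearbody N.
(* [clamp01 (2 + r)] only makes the profile vanish far on the left; near [0] the
   second factor is [c] on [[0, 1/N]], the whole averaging window at [0] *)
pose tau n r := clamp01 (2 + 1 * r) * (c * clamp01 (2 + - N n * r) +
  B r * (clamp01 (-1 + N n * r) * clamp01 (2 * N n + - N n * r))).
have ctau n : continuous (tau n).
  have clc a0 b0 : continuous (fun r => clamp01 (a0 + b0 * r)) by exact: (continuous_clamp01 (@continuous_affine a0 b0)).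
  move=> r; apply: cvgM; first exact: (clc _ _ r).
  apply: cvgD; first by apply: cvgM; [exact: cvg_cst|exact: (clc _ _ r)].
  apply: cvgM; first exact: cB.
  by apply: cvgM; exact: (clc _ _ r).
have tau_left n r : r <= -2 -> tau n r = 0.
  by move=> r2; rewrite /tau clamp01_le0 ?mul0r//; lra.
have tau_right n r : 2 <= r -> tau n r = 0.
  move=> r2; have := N1 n => n1.
  rewrite /tau (@clamp01_le0 (2 + - N n * r)); last by nra.
  by rewrite (@clamp01_le0 (2 * N n + - N n * r)) ?mulr0 ?addr0 ?mulr0//; nra.
have tau_M n r : `|tau n r| <= `|c| + M1.
  rewrite /tau normrM; have /andP[a0 a1] := clamp01_itv (2 + 1 * r).
  rewrite ger0_norm// (le_trans (ler_piMl _ a1))//.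
  rewrite (le_trans (ler_normD _ _))// !normrM.
  have /andP[b0 b1] := clamp01_itv (2 + - N n * r).
  have /andP[d0 d1] := clamp01_itv (-1 + N n * r).
  have /andP[e0 e1] := clamp01_itv (2 * N n + - N n * r).
  rewrite (ger0_norm b0) (ger0_norm d0) (ger0_norm e0) lerD//; first by rewrite ler_piMr.
  by rewrite -(normrM 2^-1); apply: le_trans (BM r); rewrite ler_piMr// mulr_ile1.
have Nv0 n : 0 < (N n)^-1 by rewrite invr_gt0.
have H n := moving_average (ctau n) (Nv0 n) (@tau_left n).
have {}H n : exists Q : (R -> R) * (R -> R) * (R -> R), [/\ forall r : R, is_derive r 1 Q.1.1 (Q.1.2 r),
    forall r : R, is_derive r 1 Q.1.2 (Q.2 r), continuous Q.2 &
    forall r, exists2 x, r < x < r + (N n)^-1 & Q.1.2 r = tau n x].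
  have [P [p [p1 HH]]] := H n.
  by exists (P, p, p1).
have [Q HQ] := choice H.
pose p n := (Q n).1.2.
have pE n r : exists2 x, r < x < r + (N n)^-1 & p n r = tau n x by have [_ _ _] := HQ n; exact.
have pM n r : `|p n r| <= `|c| + M1 by have [x _ ->] := pE n r.
have dp n (r : R) : is_derive r 1 (p n) ((Q n).2 r) by have [_ + _ _] := HQ n; exact.
have cp n : continuous (p n) by move=> r; exact: is_derive_cts (dp n r).
have p0 n : p n 0 = c.
  have [x /andP[x0 x1] ->] := pE n 0; rewrite add0r in x1.
  have Nx : N n * x <= 1 by rewrite -ler_pdivlMl// mulr1 ltW.
  have Nx0 : 0 < N n * x by rewrite mulr_gt0.
  rewrite /tau (@clamp01_ge1 (2 + 1 * x)); last by lra.
  rewrite (@clamp01_ge1 (2 + - N n * x)); last by rewrite mulNr; lra.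
  by rewrite (@clamp01_le0 (-1 + N n * x)) ?mul0r ?mulr0 ?addr0 ?mul1r ?mulr1//; lra.
have p2 n r : 2 <= r -> p n r = 0.
  by move=> r2; have [x /andP[rx _] ->] := pE n r; rewrite tau_right//; lra.
have pcvg r : 0 < r < 2 -> (fun n => p n r) @ \oo --> B r.
  move=> /andP[r0 r2]; apply/cvgrPdist_le => e e0.
  have /cvgrPdist_le/(_ _ e0)[d /= d0 Hd] := cB r.
  near=> n; have [x /andP[rx xr] ->] := pE n r.
  have n1 : (N n)^-1 < d by near: n; exact: (cvgr_lt 0 Ninv).
  have n2 : (N n)^-1 < r / 2 by near: n; apply: (cvgr_lt 0 Ninv); lra.
  have n3 : (N n)^-1 < (2 - r) / 2 by near: n; apply: (cvgr_lt 0 Ninv); lra.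
  have NV : N n * (N n)^-1 = 1 by rewrite mulfV// lt0r_neq0.
  have Nn := N0 n.
  have m2 : 1 < N n * (r / 2) by rewrite -[ltLHS]NV ltr_pM2l.
  have m3 : 1 < N n * ((2 - r) / 2) by rewrite -[ltLHS]NV ltr_pM2l.
  have m4 : N n * r < N n * x by rewrite ltr_pM2l.
  have m5 : N n * x < N n * r + 1 by rewrite -[X in _ + X]NV -mulrDr ltr_pM2l.
  rewrite /tau (@clamp01_ge1 (2 + 1 * x)); last by lra.
  rewrite (@clamp01_le0 (2 + - N n * x)); last by rewrite mulNr; lra.
  rewrite (@clamp01_ge1 (-1 + N n * x)); last by lra.
  rewrite (@clamp01_ge1 (2 * N n + - N n * x)); last by rewrite mulNr; lra.
  rewrite !mulr0 add0r !mulr1 mul1r; apply: Hd => /=.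
  by rewrite distrC ger0_norm ?subr_ge0 ?ltW// ltrBlDl (lt_trans xr)// ltrD2l.
have Br x : 0 < x < 1 -> B x = 2^-1 * b x /\ B (2 - x) = 2^-1 * b x.
  move=> /andP[x0 x1]; rewrite /B (_ : 2 - (2 - x) = x); last by ring.
  by rewrite min_l ?min_r ?clamp01_id ?x0 ?x1 ?ltW//; lra.
have cr n := continuous_refl 0 (cp n).
have bL := in_L2_within cb.
have E1 : (fun n => nrm (fun x => refl_plus (p n) 0 x - b x)) @ \oo --> (0 : R).
  apply: (@nrm_dominated_cvg0 _ _ (2 * (`|c| + M1) + M1)).
  - move=> n; apply: in_L2_measurable => //; apply: in_L2B => //.
    exact: in_L2_continuous (cr n).2.
  - move=> n x; rewrite /= in_itv/= => /andP[x0 x1].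
    rewrite (le_trans (ler_normB _ _))// lerD//; last by rewrite bb// !ltW.
    by rewrite (le_trans (ler_normD _ _))// mulr_natl mulr2n lerD.
  - move=> x; rewrite /= in_itv/= => /andP[x0 x1].
    rewrite [X in _ --> X](_ : _ = B x + B (2 - x) - b x).
      apply: cvgB; last exact: cvg_cst.
      by rewrite /refl_plus; apply: cvgD; rewrite add0r; apply: pcvg; lra.
    by have [-> ->] := Br x ltac:(lra); lra.
have E2 : (fun n => nrm (refl_minus (p n) 0)) @ \oo --> (0 : R).
  apply: (@nrm_dominated_cvg0 _ _ (2 * (`|c| + M1))).
  - move=> n; apply: in_L2_measurable => //.
    exact: in_L2_continuous (cr n).1.
  - move=> n x _.
    by rewrite (le_trans (ler_normB _ _))// mulr_natl mulr2n lerD.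
  - move=> x; rewrite /= in_itv/= => /andP[x0 x1].
    rewrite [X in _ --> X](_ : _ = B x - B (2 - x)).
      by rewrite /refl_minus; apply: cvgB; rewrite add0r; apply: pcvg; lra.
    by have [-> ->] := Br x ltac:(lra); lra.
have [n [n1 n2]] : exists n, nrm (fun x => refl_plus (p n) 0 x - b x) < eps /\
    nrm (refl_minus (p n) 0) < eps.
  near \oo => n; exists n; split; near: n.
    exact: (cvgr_lt 0 E1).
  exact: (cvgr_lt 0 E2).
have [dP _ cp1 _] := HQ n.
exists (Q n).1.1, (p n), (Q n).2; split => //; split => //; first exact: p2.
  exact: ltW.
exact: ltW.
Unshelve. all: by end_near. Qed.
End profiles.

(** * Changes of clock *)

Section filters.
Context {R : realType}.
Local Notation Om := (`]0, 1[%classic : set R).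
Implicit Types (t s a sg : R) (I : set R).

Lemma L2norm_cvg_nrm (T : Type) (Fl : set_system T) (FF : Filter Fl) (G : T -> R -> R) :
  (\forall i \near Fl, in_L2 Om (G i)) ->
  (fun i => L2norm Om (G i)) @ Fl --> 0%E ->
  (fun i => nrm (G i)) @ Fl --> (0 : R).
Proof.
move=> GL /fine_cvg; apply: cvg_trans; apply: near_eq_cvg.
by apply: filterS GL => s Gs /=; rewrite L2norm_nrm.
Qed.

Lemma dnbhs_cvg_within I t : nbhs t I -> t^' --> within I (nbhs t).
Proof.
move=> It A /= HA; have : \forall s \near t, I s -> A s by [].
move=> {}HA; apply: nbhs_dnbhs; apply: filterS2 HA It => s h Is; exact: h.
Qed.

Lemma dnbhs_cvg_dwithin I t : nbhs t I -> t^' --> within I t^'.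
Proof.
move=> It A HA.
have {}HA : \forall s \near t^', I s -> A s by exact: HA.
by apply: filterS2 HA (nbhs_dnbhs It) => s h Is; exact: h.
Qed.

(** A clock running forwards ([sg = 1]) or backwards ([sg = -1]); read on the latter,
    a backward interval of the error system satisfies the forward wave equation. *)
Definition clock sg a s : R := sg * s + a.

Lemma clock_cvg sg a s : clock sg a @ s --> clock sg a s.
Proof. by apply: cvgD; [apply: cvgM; [exact: cvg_cst|exact: cvg_id]|exact: cvg_cst]. Qed.

Lemma clock_cvg_dnbhs sg a s : sg != 0 -> clock sg a @ s^' --> (clock sg a s)^'.
Proof.
move=> sg0 A HA.
have {}HA : \forall x \near clock sg a s, x != clock sg a s -> A x by exact: HA.
have H : \forall x \near s, clock sg a x != clock sg a s -> A (clock sg a x).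
  exact: (clock_cvg HA).
have : \forall x \near s, x != s -> A (clock sg a x).
  apply: filterS H => x Hx xs; apply: Hx; rewrite /clock.
  by apply: contra_neq xs => /addIr/(mulfI sg0).
by [].
Qed.

Lemma clock_cvg_within sg a s I J : (forall x, I x -> J (clock sg a x)) ->
  clock sg a @ within I (nbhs s) --> within J (nbhs (clock sg a s)).
Proof.
move=> IJ A HA.
have {}HA : \forall x \near clock sg a s, J x -> A x by exact: HA.
have H : \forall x \near s, J (clock sg a x) -> A (clock sg a x) by exact: (clock_cvg HA).
have : \forall x \near s, I x -> A (clock sg a x).
  by apply: filterS H => x Hx /IJ; exact: Hx.
by [].
Qed.

Lemma wave_at_clock (U Ux Uxx V : R -> R -> R) sg a (g t : R) : sg = 1 \/ sg = -1 ->
  let tau := clock sg a t in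
  (\forall s \near tau,
    [/\ abs_cont (U s) (Ux s), abs_cont (Ux s) (Uxx s), in_L2 Om (V s) & U s 1 = 0]) ->
  (fun s => nrm (fun x => Ux s x - Ux tau x)) @ tau^' --> (0 : R) ->
  (fun s => nrm (fun x => Uxx s x - Uxx tau x)) @ tau^' --> (0 : R) ->
  (fun s => nrm (fun x => V s x - V tau x)) @ tau^' --> (0 : R) ->
  (fun s => nrm (fun x => (s - tau)^-1 * (U s x - U tau x) - sg * V tau x)) @ tau^' --> (0 : R) ->
  (fun s => nrm (fun x => (s - tau)^-1 * (V s x - V tau x) - sg * Uxx tau x)) @ tau^' --> (0 : R) ->
  is_derive tau 1 (fun s => U s 0) (sg * g) ->
  wave_at (U \o clock sg a) (Ux \o clock sg a) (Uxx \o clock sg a) (V \o clock sg a) g t.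
Proof.
move=> sg1 tau N cUx cUxx cV dU dV dg.
have sg0 : sg != 0 by case: sg1 => ->; rewrite ?oppr_eq0 oner_eq0.
have sgsg : sg * sg = 1 by case: sg1 => ->; rewrite ?mulrNN mulr1.
have sgV : sg^-1 = sg by apply: (mulfI sg0); rewrite mulfV.
have ac := @clock_cvg_dnbhs sg a t sg0.
have quot (F G : R -> R -> R) :
    (\forall s \near tau, in_L2 Om (F s)) -> in_L2 Om (G tau) ->
    (fun s => nrm (fun x => (s - tau)^-1 * (F s x - F tau x) - sg * G tau x)) @ tau^' --> (0 : R) ->
    (fun s => nrm (fun x => (s - t)^-1 * ((F \o clock sg a) s x - (F \o clock sg a) t x)
        - (G \o clock sg a) t x)) @ t^' --> (0 : R).
  move=> FL GL H; have {}H := cvg_comp _ _ ac H.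
  apply: cvg_trans H; apply: near_eq_cvg.
  have FLt : \forall s \near t^', in_L2 Om (F (clock sg a s)).
    by apply: nbhs_dnbhs; exact: (clock_cvg FL).
  have F0 : in_L2 Om (F tau) by exact: nbhs_singleton FL.
  apply: filterS FLt => s Fs /=.
  have L : in_L2 Om (fun x => (clock sg a s - tau)^-1 * (F (clock sg a s) x - F tau x) - sg * G tau x).
    by apply: in_L2B; [apply/in_L2Z/in_L2B|exact: in_L2Z].
  have E x : (s - t)^-1 * (F (clock sg a s) x - F (clock sg a t) x) - G (clock sg a t) x =
      sg * ((clock sg a s - tau)^-1 * (F (clock sg a s) x - F tau x) - sg * G tau x).
    have -> : clock sg a s - tau = sg * (s - t) by rewrite /tau /clock; ring.
    by rewrite invfM sgV -[LHS]mul1r -[X in X * _]sgsg -/tau; ring.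
  rewrite /nrm; congr Num.sqrt; rewrite [RHS](_ : _ = ip (fun x => sg *
    ((clock sg a s - tau)^-1 * (F (clock sg a s) x - F tau x) - sg * G tau x)) (fun x => sg *
    ((clock sg a s - tau)^-1 * (F (clock sg a s) x - F tau x) - sg * G tau x))); last first.
    by apply: eq_ip => x _; exact: E.
  by rewrite ipZl ?ipZr ?mulrA ?sgsg ?mul1r//; exact: in_L2Z.
have N0 := nbhs_singleton N.
split.
- exact: (clock_cvg N).
- exact: cvg_comp _ _ ac cUx.
- exact: cvg_comp _ _ ac cUxx.
- exact: cvg_comp _ _ ac cV.
- apply: quot => //; first by apply: filterS N => s [[]].
  by case: N0.
- apply: quot => //; first by apply: filterS N => s [].
  by case: N0 => _ [].
- have -> : g = sg * (sg * g) by rewrite mulrA sgsg mul1r.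
  exact: (@is_derive_affine _ (fun s => U s 0)).
Qed.
End filters.

(** * The error system *)

Section error.
Context {R : realType} (omega g1 g2 T : R) (q : R -> R) (y0 dy0 : R).
Context (W1 W1x W1xx W2 W2x : R -> R -> R) (Z1 Z2 Z3 : R -> R).
Context (E : error_system omega g1 g2 T q y0 dy0 W1 W1x W1xx W2 W2x Z1 Z2 Z3).
Context (g1_gt0 : 0 < g1) (g2_gt0 : 0 < g2) (T_ge2 : 2 <= T).
Local Notation Om := (`]0, 1[%classic : set R).
Local Notation I := (`[0, +oo[%classic : set R).
Implicit Types (t s a sg : R).

Let T_gt0 : 0 < T. Proof. by rewrite (lt_le_trans _ T_ge2)// ltr0n. Qed.

Lemma mem_nonneg t : I t = (0 <= t) :> Prop.
Proof. by rewrite /= in_itv/= andbT. Qed.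

Lemma err_regular t : 0 <= t -> [/\ abs_cont (W1 t) (W1x t), abs_cont (W1x t) (W1xx t),
  in_L2 Om (W2 t) & W1 t 1 = 0].
Proof.
rewrite -mem_nonneg => It; have [[H1 _ _] [H2 _ _]] := err_W1_class E.
have [H3 _ _] := err_W2_class E.
split; [exact: is_H1_abs_cont (H1 t It)|exact: is_H1_abs_cont (H2 t It)| |].
  by have [] := H3 t It.
by rewrite mem_nonneg in It; have [] := err_W_right E It.
Qed.

Lemma C_L2_in (F : R -> R -> R) t : C_L2 I Om F -> 0 <= t -> in_L2 Om (F t).
Proof. by rewrite -mem_nonneg => HF It; have [] := HF t It. Qed.

Lemma C_L2_nrm (F : R -> R -> R) t : C_L2 I Om F -> 0 <= t ->
  (fun s => nrm (fun x => F s x - F t x)) @ within I (nbhs t) --> (0 : R).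
Proof.
rewrite -mem_nonneg => HF It; have [Ft cF] := HF t It.
apply: L2norm_cvg_nrm cF.
have : \forall s \near t, I s -> in_L2 Om (fun x => F s x - F t x).
  by apply: filterE => s Is; apply: in_L2B => //; have [] := HF s Is.
by [].
Qed.

Lemma err_C_L2 : [/\ C_L2 I Om W1x, C_L2 I Om W1xx & C_L2 I Om W2].
Proof. by have [[_ _ ?] [_ _ ?]] := err_W1_class E; have [_ ? _] := err_W2_class E. Qed.

(** What the error system prescribes along a clock during a time [T], in the
    formulation common to forward and backward intervals. *)
Definition piece sg a : Prop := [/\ sg = 1 \/ sg = -1,
  forall s, 0 <= s <= T -> 0 <= clock sg a s &
  forall s, 0 < s < T -> let tau := clock sg a s in
  [/\ 0 < tau,
   (fun r => nrm (fun x => (r - tau)^-1 * (W1 r x - W1 tau x) - sg * W2 tau x)) @ tau^' --> (0 : R),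
   (fun r => nrm (fun x => (r - tau)^-1 * (W2 r x - W2 tau x) - sg * W1xx tau x)) @ tau^' --> (0 : R),
   is_derive tau 1 Z1 (sg * Z2 tau - g2 * Z1 tau) &
   is_derive tau 1 Z2 (sg * (W1x tau 0 - omega ^+ 2 * Z1 tau))]].

Lemma near_gt0 t : 0 < t -> \forall s \near t, 0 < s.
Proof. by move=> t0; exact: lt_nbhsr. Qed.

Lemma time_derivative_nrm (D : set R) (F G : R -> R -> R) sg t :
  nbhs t D -> 0 < t -> (forall s, 0 <= s -> in_L2 Om (F s)) -> in_L2 Om (G t) ->
  L2_time_derivative D Om F (fun t x => sg * G t x) ->
  (fun r => nrm (fun x => (r - t)^-1 * (F r x - F t x) - sg * G t x)) @ t^' --> (0 : R).
Proof.
move=> Dt t0 FL GL H.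
have {}H := cvg_trans (cvg_app _ (dnbhs_cvg_dwithin Dt)) (H t (nbhs_singleton Dt)).
apply: L2norm_cvg_nrm H.
apply: nbhs_dnbhs; apply: filterS (near_gt0 t0) => s s0.
by apply: in_L2B; [apply/in_L2Z/in_L2B; apply: FL|apply: in_L2Z]; rewrite ?ltW.
Qed.

Lemma piece_fwd k : piece 1 ((2 * k)%:R * T).
Proof.
have k0 : 0 <= (2 * k)%:R * T by rewrite mulr_ge0// ltW.
split; first by left.
  by move=> s /andP[s0 _]; rewrite /clock mul1r addr_ge0.
move=> s /andP[s0 sT] tau.
have tauE : tau = s + (2 * k)%:R * T by rewrite /tau /clock mul1r.
have tau0 : 0 < tau by rewrite tauE ltr_wpDr.
have ft : forward_times T k tau.
  rewrite /forward_times /= in_itv/= tauE ltrDr s0/= addrC natrD mulrDl mul1r.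
  by rewrite ltrD2l.
have nft : nbhs tau (forward_times T k) by exact: near_in_itvoo.
have [H1 H2] := err_W_forward E k.
have [D1 D2] := err_Z_forward E ft.
have [_ A2 L2 _] := err_regular (ltW tau0).
have [_ A2L _] := A2.
have mul1 (G : R -> R -> R) : (fun t x => 1 * G t x) = G.
  by apply/funext => t; apply/funext => x; rewrite mul1r.
split => //.
- apply: time_derivative_nrm nft tau0 _ L2 _; last by rewrite mul1.
  by move=> r /err_regular[[]].
- apply: time_derivative_nrm nft tau0 _ A2L _; last by rewrite mul1.
  by move=> r /err_regular[].
- by rewrite mul1r.
- by rewrite mul1r addrC -mulNr.
Qed.

Lemma piece_bwd k : piece (-1) ((2 * k + 2)%:R * T).
Proof.
have kE : (2 * k + 2)%:R * T = (2 * k + 1)%:R * T + T.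
  by rewrite (_ : (2 * k + 2 = (2 * k + 1) + 1)%N) ?addn1 ?addn2// -addn1 natrD mulrDl mul1r.
have k0 : 0 <= (2 * k + 1)%:R * T by rewrite mulr_ge0// ltW.
split; first by right.
  by move=> s /andP[s0 sT]; rewrite /clock mulN1r addrC subr_ge0 kE (le_trans sT)// lerDr.
move=> s /andP[s0 sT] tau.
have tauE : tau = (2 * k + 2)%:R * T - s by rewrite /tau /clock mulN1r addrC.
have tau0 : 0 < tau by rewrite tauE kE -addrA ltr_wpDl// subr_gt0.
have ft : backward_times T k tau.
  rewrite /backward_times /= in_itv/= tauE gtrBl s0 andbT.
  by rewrite kE -addrA ltrDl subr_gt0.
have nft : nbhs tau (backward_times T k) by exact: near_in_itvoo.
have [H1 H2] := err_W_backward E k.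
have [D1 D2] := err_Z_backward E ft.
have [_ A2 L2 _] := err_regular (ltW tau0).
have [_ A2L _] := A2.
have mul1 (G : R -> R -> R) : (fun t x => -1 * G t x) = (fun t x => - G t x).
  by apply/funext => t; apply/funext => x; rewrite mulN1r.
split => //.
- apply: time_derivative_nrm nft tau0 _ L2 _; last by rewrite mul1.
  by move=> r /err_regular[[]].
- apply: time_derivative_nrm nft tau0 _ A2L _; last by rewrite mul1.
  by move=> r /err_regular[].
- by rewrite mulN1r.
- by rewrite mulN1r opprB.
Qed.

Lemma piece_wave_at sg a s : piece sg a -> 0 < s < T ->
  wave_at (W1 \o clock sg a) (W1x \o clock sg a) (W1xx \o clock sg a) (W2 \o clock sg a)
    (g1 * Z2 (clock sg a s)) s.
Proof.
move=> [sg1 _ H] sT; have [tau0 dW1 dW2 dZ1 dZ2] := H s sT.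
have It : nbhs (clock sg a s) I.
  by apply: filterS (near_gt0 tau0) => r r0; rewrite mem_nonneg ltW.
have [c1 c2 c3] := err_C_L2.
have cc (F : R -> R -> R) : C_L2 I Om F ->
    (fun r => nrm (fun x => F r x - F (clock sg a s) x)) @ (clock sg a s)^' --> (0 : R).
  by move=> /C_L2_nrm/(_ (ltW tau0)) h; exact: cvg_trans (cvg_app _ (dnbhs_cvg_within It)) h.
apply: wave_at_clock => //; try exact: cc.
  by apply: filterS (near_gt0 tau0) => r r0; apply: err_regular; exact: ltW.
have dZ3 := err_Z3 E tau0.
have D : is_derive (clock sg a s) 1 (fun t => g1 * Z1 t + (g1 * g2) * Z3 t)
   (g1 * (sg * Z2 (clock sg a s) - g2 * Z1 (clock sg a s)) + (g1 * g2) * Z1 (clock sg a s)).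
  by apply: is_deriveD; apply: is_deriveZ.
have -> : sg * (g1 * Z2 (clock sg a s)) = g1 * (sg * Z2 (clock sg a s) - g2 * Z1 (clock sg a s)) +
   (g1 * g2) * Z1 (clock sg a s) by ring.
apply: near_eq_is_derive D => //.
by apply: filterS (near_gt0 tau0) => r r0; rewrite (err_W_left E r0).
Qed.

Definition energy_form t t' : R := ip (W1x t) (W1x t') + ip (W2 t) (W2 t')
  + g1 * (Z2 t * Z2 t' + omega ^+ 2 * (Z1 t * Z1 t')).

Lemma energy_formC t t' : energy_form t t' = energy_form t' t.
Proof.
by rewrite /energy_form ipC (ipC (W2 t)) (mulrC (Z2 t)) (mulrC (Z1 t)).
Qed.

(** The exchanges between the wave and [Z2] at [x = 0] cancel, as do those between
    [Z1] and [Z2].  The damping remains, with a sign depending on the clocks: it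
    cancels when they run in opposite directions. *)
Lemma energy_form_derive sg a sg' a' s : piece sg a -> piece sg' a' -> 0 < s < T ->
  is_derive s 1 (fun s => energy_form (clock sg a s) (clock sg' a' s))
    (- (sg + sg') * (g1 * g2 * omega ^+ 2) * (Z1 (clock sg a s) * Z1 (clock sg' a' s))).
Proof.
move=> H H' sT.
have D := wave_energy_derive (piece_wave_at H sT) (piece_wave_at H' sT).
have [sg1 _ /(_ s sT)[_ _ _ dZ1 dZ2]] := H.
have [sg1' _ /(_ s sT)[_ _ _ dZ1' dZ2']] := H'.
have {}dZ1 := is_derive_affine dZ1.
have {}dZ2 := is_derive_affine dZ2.
have {}dZ1' := is_derive_affine dZ1'.
have {}dZ2' := is_derive_affine dZ2'.
have DD := is_deriveD D (is_deriveZ g1 (is_deriveD (is_deriveM dZ2 dZ2')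
  (is_deriveZ (omega ^+ 2) (is_deriveM dZ1 dZ1')))).
apply: is_derive_eq DD _.
rewrite /GRing.scale /= -!/(clock sg a s) -!/(clock sg' a' s).
move: (clock sg a s) (clock sg' a' s) => t t'.
by case: sg1 => ->; case: sg1' => ->; ring.
Qed.

Lemma within_Z : [/\ {within I, continuous Z1}, {within I, continuous Z2} &
  {within I, continuous Z3}].
Proof.
have sub : I `<=` closure (`]0, +oo[%classic : set R).
  move=> t; rewrite mem_nonneg => t0 B [d /= d0 HB].
  exists (t + d / 2); split; first by rewrite /= in_itv/= andbT; lra.
  by apply: HB => /=; rewrite opprD addNKr normrN gtr0_norm; lra.
have [? [_ _ _ c1]] := err_Z1_class E.
have [_ c2] := err_Z2_class E.
have [? [? [[_ _ _ c3] _]]] := err_Z3_class E.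
by split => //; apply: continuous_subspaceW sub _.
Qed.

Lemma piece_cvg (F : R -> R) sg a s : (forall s, 0 <= s <= T -> 0 <= clock sg a s) ->
  0 <= s <= T -> {within I, continuous F} ->
  (F \o clock sg a) @ within `[0, T] (nbhs s) --> F (clock sg a s).
Proof.
move=> H sT /subspace_continuousP/(_ (clock sg a s)); rewrite mem_nonneg => /(_ (H s sT)) c.
apply: cvg_comp c; apply: clock_cvg_within => r /=; rewrite in_itv/= => rT.
by rewrite in_itv/= andbT; exact: H.
Qed.

Lemma piece_L2_cvg (F : R -> R -> R) sg a s : (forall s, 0 <= s <= T -> 0 <= clock sg a s) ->
  0 <= s <= T -> C_L2 I Om F ->
  (fun r => nrm (fun x => F (clock sg a r) x - F (clock sg a s) x)) @ within `[0, T] (nbhs s) --> (0 : R).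
Proof.
move=> H sT cF.
apply: cvg_comp (C_L2_nrm cF (H s sT)); apply: clock_cvg_within => r /=; rewrite in_itv/= => rT.
by rewrite in_itv/= andbT; exact: H.
Qed.

Lemma piece_in_L2 (F : R -> R -> R) sg a s : (forall s, 0 <= s <= T -> 0 <= clock sg a s) ->
  C_L2 I Om F -> \forall r \near within `[0, T] (nbhs s), in_L2 Om (F (clock sg a r)).
Proof.
move=> H cF; have : \forall r \near s, `[0, T]%classic r -> in_L2 Om (F (clock sg a r)).
  apply: filterE => r /=; rewrite in_itv/= => rT.
  exact/(C_L2_in cF)/H.
by [].
Qed.

Lemma energy_form_cts sg a sg' a' : piece sg a -> piece sg' a' ->
  {within `[0, T], continuous (fun s => energy_form (clock sg a s) (clock sg' a' s))}.
Proof.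
move=> [_ H _] [_ H' _]; apply/subspace_continuousP => s /=; rewrite in_itv/= => sT.
have [cZ1 cZ2 _] := within_Z.
have [c1 _ c3] := err_C_L2.
apply: cvgD.
  by apply: cvgD; apply: ip_cvg; try exact: piece_in_L2; try exact: piece_L2_cvg;
    apply: C_L2_in => //; [exact: H|exact: H'|exact: H|exact: H'].
apply: cvgM; first exact: cvg_cst.
apply: cvgD.
  by apply: cvgM; [exact: (piece_cvg H)|exact: (piece_cvg H')].
apply: cvgM; first exact: cvg_cst.
by apply: cvgM; [exact: (piece_cvg H)|exact: (piece_cvg H')].
Qed.

Definition cycle_start (n : nat) : R := (2 * n)%:R * T.
Definition turn_time (n : nat) : R := (2 * n + 1)%:R * T.

Lemma cycle_startS n : cycle_start n.+1 = (2 * n + 2)%:R * T.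
Proof. by rewrite /cycle_start mulnS addnC. Qed.

Lemma clock_fwd n : clock 1 (cycle_start n) T = turn_time n.
Proof. by rewrite /clock /cycle_start /turn_time mul1r natrD mulrDl mul1r addrC. Qed.

Lemma clock_bwd n : clock (-1) (cycle_start n.+1) T = turn_time n.
Proof.
rewrite /clock cycle_startS /turn_time mulN1r (_ : (2 * n + 2 = (2 * n + 1) + 1)%N); last by rewrite -addnA.
by rewrite (natrD _ (2 * n + 1)%N) mulrDl mul1r addrC addrK.
Qed.

Lemma clock_0 sg a : clock sg a 0 = a.
Proof. by rewrite /clock mulr0 add0r. Qed.

(** The backward evolution is the adjoint of the forward one: with one clock running
    backwards and the other forwards, [energy_form] is constant. *)
Lemma energy_form_adjoint n m : energy_form (cycle_start n.+1) (cycle_start m) = energy_form (turn_time n) (turn_time m).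
Proof.
have Hb := piece_bwd n; have Hf := piece_fwd m; rewrite -cycle_startS in Hb.
have D0 s : 0 < s < T ->
    is_derive s 1 (fun s => energy_form (clock (-1) (cycle_start n.+1) s) (clock 1 (cycle_start m) s)) 0.
  by move=> sT; have := energy_form_derive Hb Hf sT; rewrite addNr oppr0 !mul0r.
have := eq_of_derive0 (ltW T_gt0) (energy_form_cts Hb Hf) D0.
by rewrite !clock_0 clock_fwd clock_bwd => ->.
Qed.

(** By [energy_form_adjoint] and symmetry a unit can be moved from one index to the
    other. *)
Lemma energy_form_hankel i j : energy_form (cycle_start i) (cycle_start j) = energy_form (cycle_start 0) (cycle_start (j + i)).
Proof.
elim: i j => [|i IH] j; first by rewrite addn0.
by rewrite energy_form_adjoint energy_formC -energy_form_adjoint energy_formC IH addSnnS.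
Qed.

Lemma energy_form_diag_decr n : energy_form (cycle_start n.+1) (cycle_start n.+1) <= energy_form (cycle_start n) (cycle_start n).
Proof.
have Hb := piece_bwd n; have Hf := piece_fwd n; rewrite -cycle_startS in Hb.
have T0 := ltW T_gt0.
have pos z : 0 <= g1 * g2 * omega ^+ 2 * (z * z :> R).
  by rewrite -expr2 mulr_ge0 ?sqr_ge0// mulr_ge0 ?sqr_ge0// mulr_ge0 ?ltW.
apply: (@le_trans _ _ (energy_form (turn_time n) (turn_time n))).
  have := le_of_derive_ge0 T0 (energy_form_cts Hb Hb) (fun s => energy_form_derive Hb Hb).
  rewrite !clock_0 clock_bwd; apply => s sT; rewrite -mulrA; apply: mulr_ge0; first by lra.
  exact: pos.
have := le_of_derive_le0 T0 (energy_form_cts Hf Hf) (fun s => energy_form_derive Hf Hf).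
rewrite !clock_0 clock_fwd; apply => s sT; rewrite -mulrA; apply: mulr_le0_ge0; first by lra.
exact: pos.
Qed.

Lemma energy_form_diag_le n : energy_form (cycle_start n) (cycle_start n) <= energy_form (cycle_start 0) (cycle_start 0).
Proof. by elim: n => // n; apply: le_trans; exact: energy_form_diag_decr. Qed.

Local Notation mu := (@lebesgue_measure R).

(** Its integral over the half-line is finite, which is the decay on which all the
    limits below depend. *)
Definition sumsqZ t : R := Z1 t ^+ 2 + Z2 t ^+ 2 + Z3 t ^+ 2.

Lemma sumsqZ_integrable : mu.-integrable `]0, +oo[ (EFin \o sumsqZ).
Proof.
have [? [L1 _ _ _]] := err_Z1_class E.
have [L2 _] := err_Z2_class E.
have [? [? [[L3 _ _ _] _]]] := err_Z3_class E.
have sq (F : R -> R) : in_L2 `]0, +oo[ F -> mu.-integrable `]0, +oo[ (EFin \o (fun x => F x ^+ 2)).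
  by move=> FL; apply: in_L2_sqr_integrable => //; exact: measurable_itv.
pose f (Z : R -> R) : R -> \bar R := EFin \o (fun x => Z x ^+ 2).
rewrite (_ : EFin \o sumsqZ = (f Z1 \+ f Z2 \+ f Z3)%E); last by apply/funext.
by apply: integrableD => //; [apply: integrableD => //; exact: sq|exact: sq].
Qed.

Lemma sumsqZ_ge0 t : 0 <= sumsqZ t.
Proof. by rewrite /sumsqZ !addr_ge0 ?sqr_ge0. Qed.

Definition sumsqZ_until t : R := \int[mu]_(x in [set` `]0, t]]) sumsqZ x.

Lemma sumsqZ_integrable_itv t : mu.-integrable `]0, t] (EFin \o sumsqZ).
Proof. by apply: integrableS sumsqZ_integrable => //; apply: subset_itvl. Qed.

Lemma le_sumsqZ_Rintegral (A B : set R) : measurable A -> measurable B -> A `<=` B ->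
  mu.-integrable B (EFin \o sumsqZ) -> \int[mu]_(x in A) sumsqZ x <= \int[mu]_(x in B) sumsqZ x.
Proof.
move=> mA mB AB iB.
have iA : mu.-integrable A (EFin \o sumsqZ) by exact: integrableS iB.
apply: fine_le; try exact: integrable_fin_num.
apply: ge0_subset_integral => //; first exact: (measurable_int mu iB).
by move=> x _; rewrite lee_fin sumsqZ_ge0.
Qed.

Lemma sumsqZ_until_le s t : s <= t -> sumsqZ_until s <= sumsqZ_until t.
Proof.
move=> st; apply: le_sumsqZ_Rintegral => //; last exact: sumsqZ_integrable_itv.
by apply: subset_itvl; rewrite bnd_simp.
Qed.

Lemma sumsqZ_until_bound t : sumsqZ_until t <= \int[mu]_(x in `]0, +oo[) sumsqZ x.
Proof. by apply: le_sumsqZ_Rintegral => //; [exact: subset_itvl|exact: sumsqZ_integrable]. Qed.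

Lemma within_nonneg_cts (F : R -> R) t : {within I, continuous F} -> 0 < t -> {for t, continuous F}.
Proof.
move=> /subspace_continuousP/(_ t); rewrite mem_nonneg => H t0; have {}H := H (ltW t0).
have It : nbhs t I by apply: filterS (near_gt0 t0) => r r0; rewrite mem_nonneg ltW.
move=> A HA; have {}H : \forall x \near t, I x -> A (F x) by exact: (H A HA).
by apply: filterS2 H It => x; apply.
Qed.

Lemma sumsqZ_until_derive t : 0 < t -> is_derive t 1 sumsqZ_until (sumsqZ t).
Proof.
move=> t0; have [c1 c2 c3] := within_Z.
have cQ : {for t, continuous sumsqZ}.
  have sqc (F : R -> R) : {within I, continuous F} -> {for t, continuous (fun x => F x ^+ 2)}.
    by move=> /within_nonneg_cts/(_ t0) c; exact: (cvgM c c).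
  by apply: cvgD; [apply: cvgD|]; exact: sqc.
have [dN N'] := @continuous_FTC1 R sumsqZ (BRight 0) t (t + 1) ltac:(lra)
  (@sumsqZ_integrable_itv (t + 1)) t0 cQ.
by apply: (DeriveDef dN); rewrite -derive1E.
Qed.

Lemma cycle_start_ge0 n : 0 <= cycle_start n.
Proof. by rewrite mulr_ge0// ltW. Qed.

Lemma cycle_start_le n : cycle_start n + T <= cycle_start n.+1.
Proof. by rewrite cycle_startS /cycle_start natrD mulrDl lerD2l ler_peMl ?ler1n// ltW. Qed.

Lemma sumsqZ_until_step_cvg0 : (fun n => sumsqZ_until (cycle_start n.+1) - sumsqZ_until (cycle_start n)) @ \oo --> (0 : R).
Proof.
have cu : cvgn (fun n => sumsqZ_until (cycle_start n)).
  apply: nondecreasing_is_cvgn.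
    apply/nondecreasing_seqP => n; apply: sumsqZ_until_le.
    by apply: le_trans (cycle_start_le n); rewrite lerDl ltW.
  by exists (\int[mu]_(x in `]0, +oo[) sumsqZ x) => _ [n _ <-]; exact: sumsqZ_until_bound.
rewrite -(subrr (limn (fun n => sumsqZ_until (cycle_start n)))); apply: cvgB; last exact: cu.
by rewrite (cvg_shiftS (fun n => sumsqZ_until (cycle_start n))).
Qed.

(** A function that vanishes at the end of a window, and whose derivative is bounded
    by the [Zi], is small at the start of the window.  As [|z| <= e + z^2 / e], its
    variation is at most [3 C e L] plus [C / e] times the integral of [sumsqZ] over
    the window, and the latter tends to [0]. *)
Lemma window_cvg (C L eta : R) : 0 < L <= T -> 0 < eta ->
  \forall m \near \oo, forall G dG : R -> R,
  {within `[0, L], continuous G} ->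
  (forall s, 0 < s < L -> is_derive s 1 G (dG s)) ->
  (forall s, 0 < s < L -> `|dG s| <= C * (`|Z1 (clock 1 (cycle_start m) s)| + `|Z2 (clock 1 (cycle_start m) s)|
     + `|Z3 (clock 1 (cycle_start m) s)|)) ->
  G L = 0 -> `|G 0| <= eta.
Proof.
move=> /andP[L0 LT] eta0.
pose C' := `|C| + 1; have C'0 : 0 < C' by rewrite /C' ltr_wpDl.
(* makes the first part [3 C' e L] of the variation equal to [eta / 2] *)
pose e := eta / (6 * C' * L).
have e0 : 0 < e by rewrite divr_gt0// !mulr_gt0.
have eL : C' * (3 * e * L) = eta / 2.
  by rewrite /e; field; rewrite !gt_eqF.
pose K := C' / e; have K0 : 0 < K by rewrite divr_gt0.
have Keta : 0 < eta / 2 / K by rewrite divr_gt0// divr_gt0.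
near=> m.
have m1 : (0 < m)%N by near: m; exact: nbhs_infty_gt.
have start_gt0 : 0 < cycle_start m by rewrite mulr_gt0// ltr0n muln_gt0.
have dsum : sumsqZ_until (cycle_start m + L) - sumsqZ_until (cycle_start m) <= eta / 2 / K.
  apply: (@le_trans _ _ (sumsqZ_until (cycle_start m.+1) - sumsqZ_until (cycle_start m))).
    by rewrite lerD2r sumsqZ_until_le// (le_trans _ (cycle_start_le m))// lerD2l.
  by near: m; apply: (cvgr_le 0 sumsqZ_until_step_cvg0).
(* a lower bound suffices: it is applied to [G] and to [- G] *)
have half (G dG : R -> R) : {within `[0, L], continuous G} ->
    (forall s, 0 < s < L -> is_derive s 1 G (dG s)) ->
    (forall s, 0 < s < L -> `|dG s| <= C * (`|Z1 (clock 1 (cycle_start m) s)| + `|Z2 (clock 1 (cycle_start m) s)|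
     + `|Z3 (clock 1 (cycle_start m) s)|)) ->
    G L = 0 -> - eta <= G 0.
  move=> cG dG_ bG GL.
  pose H s := G s - (C' * (3 * e) * s + K * sumsqZ_until (clock 1 (cycle_start m) s)).
  have clock_gt0 s : 0 <= s -> 0 < clock 1 (cycle_start m) s by move=> s0; rewrite /clock mul1r ltr_wpDl.
  have dNclock s : 0 <= s -> is_derive s 1 (fun s => sumsqZ_until (clock 1 (cycle_start m) s)) (sumsqZ (clock 1 (cycle_start m) s)).
    move=> s0; have := is_derive_affine (sumsqZ_until_derive (clock_gt0 s s0)).
    by rewrite mul1r.
  have dH s : 0 < s < L -> is_derive s 1 H (dG s - (C' * (3 * e) + K * sumsqZ (clock 1 (cycle_start m) s))).
    move=> sL; have s0 : 0 <= s by lra.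
    apply: is_deriveB; first exact: dG_.
    apply: is_deriveD; last by apply: is_deriveZ; exact: dNclock.
    by apply: (@is_derive_quad _ _ _ _ 0) => r; rewrite (_ : _ - _ - _ = 0) ?normr0 ?mul0r//; ring.
  have cH : {within `[0, L], continuous H}.
    apply/subspace_continuousP => s /= sL.
    have s0 : 0 <= s by move: sL; rewrite in_itv/= => /andP[].
    apply: cvgB; first by move/subspace_continuousP : cG; exact.
    apply: cvg_within_filter; apply: cvgD.
      by apply: cvgM; [exact: cvg_cst|exact: cvg_id].
    by apply: cvgM; [exact: cvg_cst|exact: is_derive_cts (dNclock s s0)].
  have H0 s : 0 < s < L -> dG s - (C' * (3 * e) + K * sumsqZ (clock 1 (cycle_start m) s)) <= 0.
    move=> sL; rewrite subr_le0 (le_trans (ler_norm _))// (le_trans (bG s sL))//.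
    move: (clock 1 (cycle_start m) s) => t.
    have zz (z : R) : `|z| <= e + z ^+ 2 / e.
      rewrite -(ler_pM2r e0) mulrDl divfK ?gt_eqF// -[z ^+ 2]real_normK ?num_real//.
      by have := sqr_ge0 (`|z| - e); have := normr_ge0 z; nra.
    apply: (@le_trans _ _ (C' * (`|Z1 t| + `|Z2 t| + `|Z3 t|))).
      rewrite ler_wpM2r ?addr_ge0// (le_trans (ler_norm C))// /C' lerDl//.
    rewrite (_ : _ + K * _ = C' * ((e + Z1 t ^+ 2 / e) + (e + Z2 t ^+ 2 / e) + (e + Z3 t ^+ 2 / e))).
      by rewrite ler_pM2l// !lerD.
    by rewrite /K /sumsqZ; field; rewrite gt_eqF.
  have := le_of_derive_le0 (ltW L0) cH dH H0.
  rewrite /H GL mulr0 add0r clock_0 (_ : clock 1 (cycle_start m) L = cycle_start m + L); last by rewrite /clock mul1r addrC.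
  have : K * (sumsqZ_until (cycle_start m + L) - sumsqZ_until (cycle_start m)) <= eta / 2.
    by rewrite mulrC -ler_pdivlMr.
  rewrite mulrBr (_ : C' * (3 * e) * L = eta / 2); last by rewrite -eL; ring.
  by lra.
move=> G dG cG dG_ bG GL; rewrite ler_norml (half G dG)//= -lerN2.
apply: (half (fun s => - G s) (fun s => - dG s)).
- by move=> x; exact/continuousN/cG.
- by move=> s sL; apply: is_deriveN; exact: dG_.
- by move=> s sL; rewrite normrN; exact: bG.
- by rewrite GL oppr0.
Unshelve. all: by end_near. Qed.

Lemma piece_cycle_start m : piece 1 (cycle_start m).
Proof. exact: piece_fwd. Qed.

Lemma sub_itv0 (L s : R) : L <= T -> 0 <= s <= L -> 0 <= s <= T.
Proof. by move=> LT /andP[-> sL]; rewrite (le_trans sL). Qed.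

Lemma fwd_cts (F : R -> R) m (L : R) : L <= T -> {within I, continuous F} ->
  {within `[0, L], continuous (F \o clock 1 (cycle_start m))}.
Proof.
move=> LT cF; have [_ H _] := piece_cycle_start m.
apply: (@continuous_subspaceW _ _ _ `[0, T]).
  by apply: subset_itvl; rewrite bnd_simp.
apply/subspace_continuousP => s /=; rewrite in_itv/= => sT.
exact: piece_cvg H sT cF.
Qed.

(** [window_cvg] applied to [(1 - s) f]. *)
Lemma window_value_cvg0 (dF : nat -> R -> R) (f : R -> R) (C : R) :
  {within I, continuous f} ->
  (forall m s, 0 < s < 1 -> is_derive s 1 (f \o clock 1 (cycle_start m)) (dF m s)) ->
  (forall m s, 0 < s < 1 -> `|f (clock 1 (cycle_start m) s)| + `|dF m s| <=
     C * (`|Z1 (clock 1 (cycle_start m) s)| + `|Z2 (clock 1 (cycle_start m) s)| + `|Z3 (clock 1 (cycle_start m) s)|)) ->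
  (fun n => f (cycle_start n)) @ \oo --> (0 : R).
Proof.
move=> cf df bf; apply/cvgrPdist_le => e e0.
have T1 : 1 <= T by rewrite (le_trans _ T_ge2)// ler1n.
have W := @window_cvg C 1 e.
have {}W := W ltac:(by rewrite ltr01 T1) e0.
apply: filterS W => m W; rewrite sub0r normrN.
pose G s := (1 - s) * f (clock 1 (cycle_start m) s).
have d1 s : is_derive s 1 (fun s : R => 1 - s) (-1).
  by rewrite -[X in is_derive _ _ _ X]add0r; apply: is_deriveB.
have -> : f (cycle_start m) = G 0 by rewrite /G subr0 mul1r clock_0.
apply: (W G (fun s => (1 - s) * dF m s + f (clock 1 (cycle_start m) s) * -1)).
- apply/subspace_continuousP => s /= s01; apply: cvgM.
    by apply: cvg_within_filter; apply: cvgB; [exact: cvg_cst|exact: cvg_id].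
  by move/subspace_continuousP : (@fwd_cts f m 1 T1 cf); exact.
- move=> s s01; exact: (is_deriveM (d1 s) (df m s s01)).
- move=> s s01; apply: le_trans (bf m s s01).
  rewrite mulrN1 (le_trans (ler_normB _ _))// addrC lerD2l normrM ler_piMl//.
  by rewrite ler_norml; lra.
- by rewrite /G subrr mul0r.
Qed.

Lemma Z1_cvg0 : (fun n => Z1 (cycle_start n)) @ \oo --> (0 : R).
Proof.
have [cZ1 _ _] := within_Z.
apply: (@window_value_cvg0 (fun m s => 1 * (1 * Z2 (clock 1 (cycle_start m) s) - g2 * Z1 (clock 1 (cycle_start m) s)))
  _ (1 + g2) cZ1).
  move=> m s /andP[s0 s1]; have [_ _ H] := piece_cycle_start m.
  have [|_ _ _ d _] := H s; first by rewrite s0 (lt_le_trans s1)// (le_trans _ T_ge2)// ler1n.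
  exact: is_derive_affine d.
move=> m s _; move: (clock 1 (cycle_start m) s) => t; rewrite !mul1r.
have := ler_normB (Z2 t) (g2 * Z1 t); rewrite normrM (gtr0_norm g2_gt0).
have := normr_ge0 (Z1 t); have := normr_ge0 (Z2 t); have := normr_ge0 (Z3 t).
have := g2_gt0; nra.
Qed.

Lemma Z3_cvg0 : (fun n => Z3 (cycle_start n)) @ \oo --> (0 : R).
Proof.
have [_ _ cZ3] := within_Z.
apply: (@window_value_cvg0 (fun m s => 1 * Z1 (clock 1 (cycle_start m) s)) _ 1 cZ3).
  move=> m s /andP[s0 s1]; have [_ _ H] := piece_cycle_start m.
  have [|t0 _ _ _ _] := H s; first by rewrite s0 (lt_le_trans s1)// (le_trans _ T_ge2)// ler1n.
  exact: is_derive_affine (err_Z3 E t0).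
move=> m s _; move: (clock 1 (cycle_start m) s) => t; rewrite !mul1r.
have := normr_ge0 (Z1 t); have := normr_ge0 (Z2 t); lra.
Qed.

(** The derivative of the product of the test wave with the solution contains the
    trace [W1x (t, 0)]; adding [p Z2], whose derivative contains the opposite
    term, leaves only [Z1] and [Z2].  The sum vanishes at time [2], together with
    the test wave. *)
Lemma test_wave_cvg0 (P p p1 : R -> R) : (forall r : R, is_derive r 1 P (p r)) ->
  (forall r : R, is_derive r 1 p (p1 r)) -> continuous p1 ->
  (forall r, 2 <= r -> p r = 0) ->
  (fun m => ip (refl_plus p 0) (W1x (cycle_start m)) + ip (refl_minus p 0) (W2 (cycle_start m))
      + p 0 * Z2 (cycle_start m)) @ \oo --> (0 : R).
Proof.
move=> dP dp cp1 p2.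
have cp : continuous p by move=> x; exact: is_derive_cts (dp x).
have bd (h : R -> R) : continuous h -> exists2 M, 0 <= M & forall s, 0 < s < 2 -> `|h s| <= M.
  move=> ch; have ch2 : {within `[0, 2], continuous h} by exact: continuous_subspaceT.
  have [M [_ HM]] := compact_bounded (continuous_compact ch2 (@segment_compact _ 0 2)).
  exists (`|M| + 1); first by rewrite addr_ge0.
  move=> s s2; apply: (HM (`|M| + 1)); first by rewrite ltr_pwDr// ler_norm.
  by exists s => //; rewrite /= in_itv/=; lra.
have [Mp Mp0 pM] := bd p cp.
have [M1 M10 p1M] := bd p1 cp1.
have [cZ1 cZ2 _] := within_Z.
apply/cvgrPdist_le => e e0.
have T2 : 0 < (2 : R) <= T by rewrite ltr0n T_ge2.
apply: filterS (window_cvg (M1 + (omega ^+ 2 + g1) * Mp) T2 e0) => m W.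
rewrite sub0r normrN.
pose J := wave_energy (refl_plus p) (refl_minus p) (W1x \o clock 1 (cycle_start m)) (W2 \o clock 1 (cycle_start m)).
pose G s := J s + p s * (Z2 \o clock 1 (cycle_start m)) s.
have -> : ip (refl_plus p 0) (W1x (cycle_start m)) + ip (refl_minus p 0) (W2 (cycle_start m))
      + p 0 * Z2 (cycle_start m) = G 0.
  by rewrite /G /J /wave_energy /= clock_0.
have T2' := T_ge2.
pose t s := clock 1 (cycle_start m) s.
apply: (W G (fun s => - ((p s - p (s + 2)) * W1x (t s) 0 + g1 * Z2 (t s) * refl_plus p s 0)
  + (p s * (1 * (1 * (W1x (t s) 0 - omega ^+ 2 * Z1 (t s)))) + Z2 (t s) * p1 s))).
- have [_ H _] := piece_cycle_start m.
  have [c1 _ c3] := err_C_L2.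
  apply/subspace_continuousP => s /= s02.
  have s2 : 0 <= s <= 2 by move: s02; rewrite in_itv.
  have sT : 0 <= s <= T by exact: (sub_itv0 T_ge2 s2).
  have wn : within `[0, 2] (nbhs s) --> within `[0, T] (nbhs s).
    move=> A HA; have {}HA : \forall r \near s, `[0, T]%classic r -> A r by exact: HA.
    have : \forall r \near s, `[0, 2]%classic r -> A r.
      apply: filterS HA => r Hr; rewrite /= in_itv/= => r2; apply: Hr.
      by rewrite /= in_itv/=; exact: (sub_itv0 T_ge2 r2).
    by [].
  have cL r := continuous_refl r cp.
  apply: cvgD; last first.
    apply: cvgM; first by apply: cvg_within_filter; exact: cp.
    by move/subspace_continuousP : (@fwd_cts Z2 m 2 T_ge2 cZ2); apply.
  apply: cvgD; apply: ip_cvg.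
  + by apply: nearW => r; exact: in_L2_continuous (cL r).2.
  + by apply: wn; exact: piece_in_L2.
  + exact: in_L2_continuous (cL s).2.
  + exact/(C_L2_in c1)/H.
  + by apply: cvg_within_filter; exact: (refl_unif s cp).2.
  + apply: cvg_trans (piece_L2_cvg H sT c1); exact: cvg_app wn.
  + by apply: nearW => r; exact: in_L2_continuous (cL r).1.
  + by apply: wn; exact: piece_in_L2.
  + exact: in_L2_continuous (cL s).1.
  + exact/(C_L2_in c3)/H.
  + by apply: cvg_within_filter; exact: (refl_unif s cp).1.
  + apply: cvg_trans (piece_L2_cvg H sT c3); exact: cvg_app wn.
- move=> s /andP[s0 s2]; have [_ _ H] := piece_cycle_start m.
  have sT : 0 < s < T by rewrite s0 (lt_le_trans s2).
  have [_ _ _ _ d2] := H s sT.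
  apply: is_deriveD.
    exact: wave_energy_derive (test_wave_at dP dp cp1 s) (piece_wave_at (piece_cycle_start m) sT).
  exact: (is_deriveM (dp s) (is_derive_affine d2)).
- move=> s s02; rewrite -/(t s); move: (t s) => r.
  have /andP[s0 s2] := s02.
  rewrite /refl_plus addr0 subr0 (p2 (s + 2)); last by lra.
  have := pM s s02; have := p1M s s02.
  have -> : - ((p s - 0) * W1x r 0 + g1 * Z2 r * (p s + 0)) +
    (p s * (1 * (1 * (W1x r 0 - omega ^+ 2 * Z1 r))) + Z2 r * p1 s) =
    p1 s * Z2 r - omega ^+ 2 * (p s * Z1 r) - g1 * (p s * Z2 r) by ring.
  move=> h1 h2; have := sqr_ge0 omega; move: (omega ^+ 2) => o o2.
  rewrite (le_trans (ler_normB _ _))//.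
  rewrite (@le_trans _ _ (M1 * `|Z2 r| + o * (Mp * `|Z1 r|) + g1 * (Mp * `|Z2 r|)))//.
    rewrite lerD//.
      rewrite (le_trans (ler_normB _ _))// lerD// !normrM; first by rewrite ler_wpM2r.
      by rewrite (ger0_norm o2) ler_wpM2l// ler_wpM2r.
    by rewrite !normrM (gtr0_norm g1_gt0) ler_wpM2l ?(ltW g1_gt0)// ler_wpM2r.
  have z1 := normr_ge0 (Z1 r); have z2 := normr_ge0 (Z2 r); have z3 := normr_ge0 (Z3 r).
  have gg := ltW g1_gt0.
  rewrite -subr_ge0 (_ : _ - _ = M1 * `|Z1 r| + M1 * `|Z3 r| + o * Mp * `|Z2 r|
    + g1 * Mp * `|Z1 r| + (o + g1) * Mp * `|Z3 r|); last by ring.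
  by rewrite !addr_ge0// !mulr_ge0// addr_ge0.
- rewrite /G p2// mul0r addr0 /J /wave_energy.
  have L0 (f : R -> R) : ip (fun=> 0) f = 0 by rewrite ipC ip0r.
  rewrite (@eq_ip _ _ (fun=> 0) _ (W1x (clock 1 (cycle_start m) 2))) ?L0//; last first.
    move=> x; rewrite /= in_itv/= => /andP[x0 x1].
    by rewrite /refl_plus !p2 ?addr0//; lra.
  rewrite (@eq_ip _ _ (fun=> 0) _ (W2 (clock 1 (cycle_start m) 2))) ?L0 ?addr0//.
  move=> x; rewrite /= in_itv/= => /andP[x0 x1].
  by rewrite /refl_minus !p2 ?subr0//; lra.
Qed.

Lemma nrm_energy_form_le n : nrm (W1x (cycle_start n)) ^+ 2 + nrm (W2 (cycle_start n)) ^+ 2 + g1 * Z2 (cycle_start n) ^+ 2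
  <= energy_form (cycle_start n) (cycle_start n).
Proof.
rewrite /energy_form !nrm_sqr lerD2l ler_wpM2l ?(ltW g1_gt0)// -!expr2 lerDl.
by rewrite mulr_ge0 ?sqr_ge0.
Qed.

(** The wave component of the initial state is approximated by test data; the error
    is controlled by the bound [K] on the norms of the solution. *)
Lemma energy_form_weak_cvg0 : (fun m => energy_form (cycle_start 0) (cycle_start m)) @ \oo --> (0 : R).
Proof.
have tx0 : cycle_start 0 = 0 by rewrite /cycle_start muln0 mul0r.
have [A0 A1 L2 _] := err_regular (lexx 0).
have [_ L1 _] := A0.
have W20 x : Om x -> W2 0 x = 0 by move=> Ox; have [] := err_W_init E Ox.
have cb : {within `[0, 1], continuous (W1x 0)}.
  have [_ [H _ _]] := err_W1_class E.
  by apply: is_H1_within (H 0 _); rewrite mem_nonneg.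
pose K := Num.sqrt (energy_form (cycle_start 0) (cycle_start 0)).
have K0 : 0 <= K by exact: sqrtr_ge0.
have nb n : nrm (W1x (cycle_start n)) <= K /\ nrm (W2 (cycle_start n)) <= K.
  have h := le_trans (nrm_energy_form_le n) (energy_form_diag_le n).
  have gz : 0 <= g1 * Z2 (cycle_start n) ^+ 2 by rewrite mulr_ge0 ?sqr_ge0// ltW.
  have n1 := sqr_ge0 (nrm (W1x (cycle_start n))); have n2 := sqr_ge0 (nrm (W2 (cycle_start n))).
  split; rewrite -[leLHS]ger0_norm ?nrm_ge0// -sqrtr_sqr ler_wsqrtr//; lra.
apply/cvgrPdist_le => e e0.
(* four terms: the two approximation errors, the test wave, and [Z1] *)
pose eps := e / (4 * (K + 1)).
have eps0 : 0 < eps by rewrite divr_gt0// mulr_gt0// ltr_wpDl.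
have epsK : eps * K <= e / 4.
  rewrite /eps -mulrA ler_pM2l// invfM -mulrA ler_piMr ?invr_ge0//.
  by rewrite mulrC ler_pdivrMr ?mul1r ?lerDl// ltr_wpDl.
have [P [p [p1 [dP dp cp1 [p0 p2] [e1 e2]]]]] := test_family (g1 * Z2 0) cb eps0.
have cp : continuous p by move=> x; exact: is_derive_cts (dp x).
have Lp := in_L2_continuous (continuous_refl 0 cp).2.
have Lm := in_L2_continuous (continuous_refl 0 cp).1.
have J0 := test_wave_cvg0 dP dp cp1 p2.
have Z0 : (fun m => g1 * omega ^+ 2 * Z1 0 * Z1 (cycle_start m)) @ \oo --> (0 : R).
  rewrite -[X in _ --> X](mulr0 (g1 * omega ^+ 2 * Z1 0)).
  by apply: cvgM; [exact: cvg_cst|exact: Z1_cvg0].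
have e4 : 0 < e / 4 by rewrite divr_gt0.
near=> m.
have j4 : `|ip (refl_plus p 0) (W1x (cycle_start m)) + ip (refl_minus p 0) (W2 (cycle_start m))
      + p 0 * Z2 (cycle_start m)| <= e / 4.
  by rewrite -normrN -sub0r; near: m; move/cvgrPdist_le : J0; exact.
have z4 : `|g1 * omega ^+ 2 * Z1 0 * Z1 (cycle_start m)| <= e / 4.
  by rewrite -normrN -sub0r; near: m; move/cvgrPdist_le : Z0; exact.
have [n1 n2] := nb m.
have [[_ Lx _] _ LV _] := err_regular (cycle_start_ge0 m).
have i1 : `|ip (fun x => refl_plus p 0 x - W1x 0 x) (W1x (cycle_start m))| <= e / 4.
  apply: le_trans epsK; apply: le_trans (ler_normip _ _) _ => //; first exact: in_L2B.
  by apply: ler_pM; rewrite ?nrm_ge0.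
have i2 : `|ip (refl_minus p 0) (W2 (cycle_start m))| <= e / 4.
  apply: le_trans epsK; apply: le_trans (ler_normip _ _) _ => //.
  by apply: ler_pM; rewrite ?nrm_ge0.
rewrite sub0r normrN.
have -> : energy_form (cycle_start 0) (cycle_start m) =
   (ip (refl_plus p 0) (W1x (cycle_start m)) + ip (refl_minus p 0) (W2 (cycle_start m)) + p 0 * Z2 (cycle_start m))
   - ip (fun x => refl_plus p 0 x - W1x 0 x) (W1x (cycle_start m))
   - ip (refl_minus p 0) (W2 (cycle_start m)) + g1 * omega ^+ 2 * Z1 0 * Z1 (cycle_start m).
  rewrite /energy_form tx0 ipBl// p0 (_ : ip (W2 0) _ = 0); first by ring.
  by rewrite (@eq_ip _ _ (fun=> 0) _ (W2 (cycle_start m))) 1?ipC ?ip0r.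
move: j4 i1 i2 z4; rewrite !ler_norml.
by move=> /andP[? ?] /andP[? ?] /andP[? ?] /andP[? ?]; apply/andP; split; lra.
Unshelve. all: by end_near. Qed.

(** The Hankel structure upgrades the weak limit to a strong one. *)
Lemma energy_form_diag_cvg0 : (fun n => energy_form (cycle_start n) (cycle_start n)) @ \oo --> (0 : R).
Proof.
have -> : (fun n => energy_form (cycle_start n) (cycle_start n)) = (fun m => energy_form (cycle_start 0) (cycle_start m)) \o (fun n => (n + n)%N).
  by apply/funext => n; rewrite /= energy_form_hankel.
apply: (cvg_comp _ _ _ energy_form_weak_cvg0) => A [N _ HN]; exists N => // n /= Nn.
by apply: HN => /=; rewrite (leq_trans Nn)// leq_addr.
Qed.

Lemma sqr_bounded_cvg0 (u : nat -> R) (c : R) : 0 < c ->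
  (forall n, c * u n ^+ 2 <= energy_form (cycle_start n) (cycle_start n)) -> u @ \oo --> (0 : R).
Proof.
move=> c0 uc; apply/cvgrPdist_le => e e0.
have ce : 0 < c * e ^+ 2 by rewrite mulr_gt0// exprn_gt0.
have /cvgrPdist_le/(_ _ ce) := energy_form_diag_cvg0; apply: filterS => n.
rewrite !sub0r !normrN => h.
rewrite -(ger0_norm (ltW e0)) -ler_sqr ?nnegrE// ?real_normK ?num_real//.
rewrite -(ler_pM2l c0) (le_trans (uc n))// (le_trans (ler_norm _))// ger0_norm ?ltW//.
Qed.

Lemma error_limits :
  [/\ (fun n : nat => H1norm Om (W1 (cycle_start n)) (W1x (cycle_start n))) @ \oo --> 0%E,
      (fun n : nat => L2norm Om (W2 (cycle_start n))) @ \oo --> 0%E &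
      [/\ (fun n : nat => Z1 (cycle_start n)) @ \oo --> (0 : R),
          (fun n : nat => Z2 (cycle_start n)) @ \oo --> (0 : R) &
          (fun n : nat => Z3 (cycle_start n)) @ \oo --> (0 : R)]].
Proof.
have s1 n := sqr_ge0 (nrm (W1x (cycle_start n))).
have s2 n := sqr_ge0 (nrm (W2 (cycle_start n))).
have s3 n : 0 <= g1 * Z2 (cycle_start n) ^+ 2 by rewrite mulr_ge0 ?sqr_ge0// ltW.
have c1 : (fun n => nrm (W1x (cycle_start n))) @ \oo --> (0 : R).
  apply: (sqr_bounded_cvg0 ltr01) => n; apply: le_trans (nrm_energy_form_le n).
  by rewrite mul1r -addrA lerDl addr_ge0.
have c2 : (fun n => nrm (W2 (cycle_start n))) @ \oo --> (0 : R).
  apply: (sqr_bounded_cvg0 ltr01) => n; apply: le_trans (nrm_energy_form_le n).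
  by rewrite mul1r addrAC lerDr addr_ge0.
have c3 : (fun n => Z2 (cycle_start n)) @ \oo --> (0 : R).
  apply: (sqr_bounded_cvg0 g1_gt0) => n; apply: le_trans (nrm_energy_form_le n).
  by rewrite lerDr addr_ge0.
have c0 : (fun n => nrm (W1 (cycle_start n))) @ \oo --> (0 : R).
  apply: (@squeeze_cvgr _ _ _ _ (cst 0) (fun n => nrm (W1x (cycle_start n)))) => //; last exact: cvg_cst.
  apply: nearW => n; rewrite /= nrm_ge0/=.
  by have [A _ _ h1] := err_regular (cycle_start_ge0 n); exact: abs_cont_poincare A h1.
have L n : [/\ in_L2 Om (W1 (cycle_start n)), in_L2 Om (W1x (cycle_start n)) & in_L2 Om (W2 (cycle_start n))].
  by have [[? ? _] _ ? _] := err_regular (cycle_start_ge0 n).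
split.
- rewrite (_ : (fun n => _) = EFin \o (fun n => nrm (W1 (cycle_start n)) + nrm (W1x (cycle_start n)))); last first.
    by apply/funext => n; have [? ? _] := L n; rewrite /H1norm !L2norm_nrm.
  apply: cvg_EFin; first by apply: nearW.
  by rewrite /comp /= -[X in _ --> X](addr0 0); apply: cvgD.
- rewrite (_ : (fun n => _) = EFin \o (fun n => nrm (W2 (cycle_start n)))); last first.
    by apply/funext => n; have [_ _ ?] := L n; rewrite L2norm_nrm.
  by apply: cvg_EFin => //; apply: nearW.
- by split; [exact: Z1_cvg0|exact: c3|exact: Z3_cvg0].
Qed.
End error.

Theorem theorem8 (R : realType) (omega g1 g2 T : R) (q y dy : R -> R)
    (W1 W1x W1xx W2 W2x : R -> R -> R) (Z1 Z2 Z3 : R -> R)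
    (g1_gt0 : 0 < g1) (g2_gt0 : 0 < g2) (T_ge2 : 2 <= T)
    (q_reg : H2_H10 q)
    (y_output : source_output T omega q y)
    (y_H2 : exists ddy : R -> R, is_H2 `]0, T[ y dy ddy)
    (WZ_sol : error_system omega g1 g2 T q (y 0) (dy 0)
                W1 W1x W1xx W2 W2x Z1 Z2 Z3) :
  [/\ (fun n : nat => H1norm `]0, 1[ (W1 ((2 * n)%:R * T)) (W1x ((2 * n)%:R * T)))
        @ \oo --> 0%E,
      (fun n : nat => L2norm `]0, 1[ (W2 ((2 * n)%:R * T))) @ \oo --> 0%E &
      [/\ (fun n : nat => Z1 ((2 * n)%:R * T)) @ \oo --> (0 : R),
          (fun n : nat => Z2 ((2 * n)%:R * T)) @ \oo --> (0 : R) &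
          (fun n : nat => Z3 ((2 * n)%:R * T)) @ \oo --> (0 : R)]].
Proof. exact: error_limits WZ_sol g1_gt0 g2_gt0 T_ge2. Qed.
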